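(* Let $R$ be a ring, $\mathfrak l=\mathfrak l_R$ be the left localization radical of $R$, $\mathrm{Min}(R,\mathfrak l)$ be the set of minimal primes over the ideal $\mathfrak l$, and $\pi_{\mathfrak l}:R\to R/\mathfrak l$, $r\mapsto r+\mathfrak l$. The following statements are equivalent. 1. The ring $R/\mathfrak l$ has a semisimple left quotient ring, i.e. $R/\mathfrak l$ is a semiprime left Goldie ring. 2. (a) $|\mathrm{max.Den}_l(R)|<\infty$; and (b) for every $S\in\mathrm{max.Den}_l(R)$, $S^{-1}R$ is a simple left Artinian ring. 3. (a) $\mathfrak l=\bigcap_{\mathfrak p\in\mathrm{Min}(R,\mathfrak l)}\mathfrak p$; (b) $\mathrm{Min}(R,\mathfrak l)$ is a finite set; (c) for all $\mathfrak p\in\mathrm{Min}(R,\mathfrak l)$, the set $S_{\mathfrak p}:=\{c\in R\mid c+\mathfrak p\in\mathcal C_{R/\mathfrak p}\}$ is a left denominator set of $R$ with $\mathrm{ass}(S_{\mathfrak p})=\mathfrak p$; (d) for each $\mathfrak p\in\mathrm{Min}(R,\mathfrak l)$, $S_{\mathfrak p}^{-1}R$ is a simple left Artinian ring; and (e) for each $\mathfrak p\in\mathrm{Min}(R,\mathfrak l)$ and each $l\in\mathfrak l$, there is an element $s\in S_{\mathfrak p}$ such that $sl=0$. 4. (a) $\mathfrak l=\bigcap_{\mathfrak p\in\mathrm{Min}(R,\mathfrak l)}\mathfrak p$; (b) $\mathrm{Min}(R,\mathfrak l)$ is a finite set; and (c) for each $\mathfrak p\in\mathrm{Min}(R,\mathfrak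 l)$, $R/\mathfrak p$ is a left Goldie ring. If one of the equivalent conditions 1--3 holds then: (i) The map $\pi_{\mathfrak l}':\mathrm{max.Den}_l(R)\to\mathrm{max.Den}_l(R/\mathfrak l)$, $S\mapsto\pi_{\mathfrak l}(S)$, is a bijection with inverse $T\mapsto\pi_{\mathfrak l}^{-1}(T)$. (ii) $\mathrm{max.Den}_l(R)=\{S_{\mathfrak p}\mid\mathfrak p\in\mathrm{Min}(R,\mathfrak l)\}$. (iii) $\mathrm{max.Den}_l(R/\mathfrak l)=\{S_{\mathfrak p/\mathfrak l}\mid\mathfrak p\in\mathrm{Min}(R,\mathfrak l)\}$ where $S_{\mathfrak p/\mathfrak l}:=\pi_{\mathfrak l}(S_{\mathfrak p})$. (iv) For all $\mathfrak p\in\mathrm{Min}(R,\mathfrak l)$, $S_{\mathfrak p}=\pi_{\mathfrak l}^{-1}(S_{\mathfrak p/\mathfrak l})$, $\mathrm{ass}(S_{\mathfrak p/\mathfrak l})=\mathrm{ass}(S_{\mathfrak p})/\mathfrak l$, and $S_{\mathfrak p}^{-1}R\simeq S_{\mathfrak p/\mathfrak l}^{-1}(R/\mathfrak l)$ is a simple left Artinian ring.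
   Context: Rings are associative with $1\neq0$. A multiplicative subset of a ring $R$ is a subset $S$ closed under multiplication with $1\in S$, $0\notin S$. It is a left Ore set if $Sr\cap Rs\neq\emptyset$ for all $r\in R$, $s\in S$. For such $S$ put $\mathrm{ass}(S):=\{r\in R\mid sr=0\text{ for some }s\in S\}$ (an ideal of $R$). A left Ore set $S$ is a left denominator set if $rs=0$ with $r\in R,s\in S$ implies $r\in\mathrm{ass}(S)$. Then $S^{-1}R=\{s^{-1}r\mid s\in S,r\in R\}$ is the left localization of $R$ at $S$. $\mathrm{max.Den}_l(R)$ is the set of left denominator sets of $R$ that are maximal with respect to inclusion (it is known to be non-empty for every ring). The left localization radical of $R$ is $\mathfrak l_R:=\bigcap_{S\in\mathrm{max.Den}_l(R)}\mathrm{ass}(S)$. $\mathcal C_A$ is the set of regular elements (non-zero-divisors) of a ring $A$. The ring $A$ has a left quotient ring if $\mathcal C_A$ is a left Ore set, and then the left quotient ring is $\mathcal C_A^{-1}A$. Semisimple means semisimple Artinian. A left Goldie ring is a ring with the ascending chain condition on left annihilators that does not contain infinite direct sums of nonzero left ideals. *)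

(* Defs.v *)
(* Noncommutative rings are MathComp [nzRingType]s (associative, 1 != 0); ideals
   and multiplicative subsets are [set R]s of MathComp-Analysis' classical sets. *)
From HB Require Import structures.
From mathcomp Require Import all_boot all_algebra.
From mathcomp Require Import boolp classical_sets functions cardinality.

Set Implicit Arguments.
Unset Strict Implicit.
Unset Printing Implicit Defensive.

Import GRing.Theory.

Local Open Scope classical_set_scope.
Local Open Scope quotient_scope.
Local Open Scope ring_scope.

Section Ideals.
Variable R : nzRingType.
Implicit Types I J L : set R.

Definition left_ideal L : Prop :=
  [/\ L 0, forall x y, L x -> L y -> L (x + y) & forall a x, L x -> L (a * x)].

Definition two_sided_ideal I : Prop :=
  left_ideal I /\ forall a x, I x -> I (x * a).

Definition prime_ideal I : Prop :=
  [/\ two_sided_ideal I, ~ I 1 &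
      forall J K : set R, two_sided_ideal J -> two_sided_ideal K ->
        (forall x y, J x -> K y -> I (x * y)) -> J `<=` I \/ K `<=` I].

Definition simple_ring : Prop :=
  forall I, two_sided_ideal I -> I = [set 0] \/ I = setT.

Definition left_artinian : Prop :=
  forall L : nat -> set R, (forall n, left_ideal (L n)) ->
    (forall n, L n.+1 `<=` L n) -> exists N, forall n, (N <= n)%N -> L n = L N.

Definition minimal_left_ideal L : Prop :=
  [/\ left_ideal L, L != [set 0] &
      forall L', left_ideal L' -> L' `<=` L -> L' = [set 0] \/ L' = L].

(* The second clause says that the left regular module is the sum of its simple
   submodules. *)
Definition semisimple_artinian : Prop :=
  left_artinian /\
  forall x : R, exists (n : nat) (y : 'I_n -> R),
    (forall i, exists2 L, minimal_left_ideal L & L (y i)) /\ x = \sum_i y i.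

Definition semiprime_ring : Prop :=
  forall I, two_sided_ideal I ->
    (forall x y, I x -> I y -> x * y = 0) -> I = [set 0].

Definition left_annihilator (X : set R) : set R :=
  [set r | forall x, X x -> r * x = 0].

Definition acc_left_annihilators : Prop :=
  forall X : nat -> set R,
    (forall n, left_annihilator (X n) `<=` left_annihilator (X n.+1)) ->
    exists N, forall n, (N <= n)%N ->
      left_annihilator (X n) = left_annihilator (X N).

Definition independent_left_ideals (L : nat -> set R) : Prop :=
  forall (n : nat) (x : 'I_n -> R), (forall i : 'I_n, L i (x i)) ->
    \sum_i x i = 0 -> forall i : 'I_n, x i = 0.

Definition left_goldie : Prop :=
  acc_left_annihilators /\
  ~ exists L : nat -> set R,
      (forall n, left_ideal (L n) /\ L n != [set 0]) /\
      independent_left_ideals L.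

End Ideals.
Arguments simple_ring R : clear implicits.
Arguments left_artinian R : clear implicits.
Arguments semisimple_artinian R : clear implicits.
Arguments semiprime_ring R : clear implicits.
Arguments left_goldie R : clear implicits.

Definition simple_left_artinian (R : nzRingType) : Prop :=
  simple_ring R /\ left_artinian R.

Definition ring_isomorphic (A B : nzRingType) : Prop :=
  exists f : {rmorphism A -> B}, bijective f.

Record properIdeal (R : nzRingType) := ProperIdeal {
  properIdeal_set :> set R;
  properIdeal_two_sided : two_sided_ideal properIdeal_set;
  properIdeal_proper : ~ properIdeal_set 1 }.

Section QuotientRing.
Variables (R : nzRingType) (J : properIdeal R).
Local Notation I := (properIdeal_set J).

Let I0 : I 0. Proof. by case: (properIdeal_two_sided J) => -[]. Qed.
Let ID x y : I x -> I y -> I (x + y).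
Proof. by case: (properIdeal_two_sided J) => -[] _ + _ _; exact. Qed.
Let IMl a x : I x -> I (a * x).
Proof. by case: (properIdeal_two_sided J) => -[] _ _ + _; exact. Qed.
Let IMr a x : I x -> I (x * a).
Proof. by case: (properIdeal_two_sided J) => _; exact. Qed.
Let IN x : I x -> I (- x). Proof. by move=> Ix; rewrite -mulN1r; exact: IMl. Qed.

Definition quot_eqv (x y : R) : bool := `[< I (x - y) >].

Lemma quot_eqv_is_equiv : equiv_class_of quot_eqv.
Proof.
split=> [x|x y|y x z]; first by apply/asboolP; rewrite subrr.
  by apply/asboolP/asboolP => /IN; rewrite opprB.
move=> /asboolP xy /asboolP yz; apply/asboolP.
by rewrite -[x](addrNK y) -addrA; exact: ID.
Qed.

Canonical quot_eqv_equiv := EquivRelPack quot_eqv_is_equiv.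
Canonical quot_eqv_encModRel := defaultEncModRel quot_eqv.

Definition quot_ring : Type := {eq_quot quot_eqv}.
HB.instance Definition _ := Choice.on quot_ring.
HB.instance Definition _ : EqQuotient R quot_eqv quot_ring :=
  EqQuotient.on quot_ring.

Definition quot_pi (x : R) : quot_ring := \pi_quot_ring x.

Lemma quot_piP x y : quot_pi x = quot_pi y <-> I (x - y).
Proof.
rewrite /quot_pi; split=> [/eqmodP/asboolP//|xy].
by apply/eqmodP/asboolP.
Qed.

Lemma quot_pi_repr (u : quot_ring) : quot_pi (repr u) = u. Proof. exact: reprK. Qed.

Definition quot_zero := quot_pi 0.
Definition quot_one := quot_pi 1.
Definition quot_opp (u : quot_ring) := quot_pi (- repr u).
Definition quot_add (u v : quot_ring) := quot_pi (repr u + repr v).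
Definition quot_mul (u v : quot_ring) := quot_pi (repr u * repr v).

Let reprB x : I (repr (quot_pi x) - x).
Proof. by apply/quot_piP; rewrite quot_pi_repr. Qed.

Lemma quot_piN x : quot_opp (quot_pi x) = quot_pi (- x).
Proof. by apply/quot_piP; rewrite -opprD; exact/IN/reprB. Qed.
Lemma quot_piD x y : quot_add (quot_pi x) (quot_pi y) = quot_pi (x + y).
Proof. by apply/quot_piP; rewrite opprD addrACA; exact: ID. Qed.
Lemma quot_piM x y : quot_mul (quot_pi x) (quot_pi y) = quot_pi (x * y).
Proof.
apply/quot_piP; set x' := repr _; set y' := repr _.
rewrite -[x' * y'](addrNK (x' * y)) -mulrBr -addrA -mulrBl.
by apply: ID; [exact/IMl/reprB | exact/IMr/reprB].
Qed.

Lemma quot_piW (P : quot_ring -> Prop) :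
  (forall x, P (quot_pi x)) -> forall u, P u.
Proof. by move=> Px u; rewrite -[u]quot_pi_repr. Qed.

Lemma quot_addA : associative quot_add.
Proof.
by move=> u v w; elim/quot_piW: u => u; elim/quot_piW: v => v;
   elim/quot_piW: w => w; rewrite !quot_piD addrA.
Qed.
Lemma quot_addC : commutative quot_add.
Proof.
by move=> u v; elim/quot_piW: u => u; elim/quot_piW: v => v;
   rewrite !quot_piD addrC.
Qed.
Lemma quot_add0 : left_id quot_zero quot_add.
Proof. by elim/quot_piW=> ?; rewrite quot_piD add0r. Qed.
Lemma quot_addN : left_inverse quot_zero quot_opp quot_add.
Proof. by elim/quot_piW=> ?; rewrite quot_piN quot_piD addNr. Qed.
Lemma quot_mulA : associative quot_mul.
Proof.
by move=> u v w; elim/quot_piW: u => u; elim/quot_piW: v => v;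
   elim/quot_piW: w => w; rewrite !quot_piM mulrA.
Qed.
Lemma quot_mul1l : left_id quot_one quot_mul.
Proof. by elim/quot_piW=> ?; rewrite quot_piM mul1r. Qed.
Lemma quot_mul1r : right_id quot_one quot_mul.
Proof. by elim/quot_piW=> ?; rewrite quot_piM mulr1. Qed.
Lemma quot_mulDl : left_distributive quot_mul quot_add.
Proof.
by move=> u v w; elim/quot_piW: u => u; elim/quot_piW: v => v;
   elim/quot_piW: w => w; rewrite !(quot_piM, quot_piD) mulrDl.
Qed.
Lemma quot_mulDr : right_distributive quot_mul quot_add.
Proof.
by move=> u v w; elim/quot_piW: u => u; elim/quot_piW: v => v;
   elim/quot_piW: w => w; rewrite !(quot_piM, quot_piD) mulrDr.
Qed.
Lemma quot_one_neq0 : quot_one != quot_zero.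
Proof.
by apply/eqP => /quot_piP; rewrite subr0; exact: properIdeal_proper.
Qed.

HB.instance Definition _ := GRing.isZmodule.Build quot_ring
  quot_addA quot_addC quot_add0 quot_addN.
HB.instance Definition _ := GRing.Zmodule_isNzRing.Build quot_ring
  quot_mulA quot_mul1l quot_mul1r quot_mulDl quot_mulDr quot_one_neq0.

Lemma quot_pi_is_zmod_morphism : zmod_morphism quot_pi.
Proof. by move=> x y; rewrite -quot_piD -quot_piN. Qed.
HB.instance Definition _ :=
  GRing.isZmodMorphism.Build R quot_ring quot_pi quot_pi_is_zmod_morphism.
Lemma quot_pi_is_monoid_morphism : monoid_morphism quot_pi.
Proof. by split=> // x y; rewrite -quot_piM. Qed.
HB.instance Definition _ :=
  GRing.isMonoidMorphism.Build R quot_ring quot_pi quot_pi_is_monoid_morphism.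

End QuotientRing.
Arguments quot_pi {R} J x.

Section DenominatorSets.
Variable R : nzRingType.
Implicit Types S T : set R.

Definition multiplicative_set S : Prop :=
  [/\ S 1, ~ S 0 & forall s t, S s -> S t -> S (s * t)].

Definition left_ore_set S : Prop :=
  multiplicative_set S /\
  forall r s, S s -> exists t q, S t /\ t * r = q * s.

Definition ass S : set R := [set r | exists2 s, S s & s * r = 0].

Definition left_den_set S : Prop :=
  left_ore_set S /\ forall r s, S s -> r * s = 0 -> ass S r.

Definition max_den : set (set R) :=
  [set S | left_den_set S /\
           forall T, left_den_set T -> S `<=` T -> T = S].

Definition regular : set R := [set c | GRing.lreg c /\ GRing.rreg c].

Lemma regular_left_den : left_ore_set regular -> left_den_set regular.
Proof.
move=> oreC; split=> // r s [_ sreg] rs0; exists 1; first by case: oreC => -[].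
by rewrite mul1r; apply: sreg; rewrite rs0 mul0r.
Qed.

End DenominatorSets.
Arguments max_den R : clear implicits.
Arguments regular R : clear implicits.

Section LeftLocalization.
Variables (R : nzRingType) (S : set R) (denS : left_den_set S).

Let S1 : S 1. Proof. by case: denS => -[[]]. Qed.
Let S0 : ~ S 0. Proof. by case: denS => -[[]]. Qed.
Let SM s t : S s -> S t -> S (s * t).
Proof. by case: denS => -[[_ _ +] _] _; exact. Qed.
Let ore r s : S s -> exists t q, S t /\ t * r = q * s.
Proof. by case: denS => -[_ +] _; exact. Qed.
Let cancel_den r r' s : S s -> r * s = r' * s -> exists2 t, S t & t * r = t * r'.
Proof.
move=> Ss rs; case: denS => _ /(_ (r - r') s Ss) [|t St].
  by rewrite mulrBl rs subrr.
by rewrite mulrBr => /subr0_eq; exists t.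
Qed.

(* Pairs (s, r) with s in S, standing for the fraction s^-1 r. *)
Definition frac : Type := {x : R * R | `[< S x.1 >]}.
HB.instance Definition _ := Choice.on frac.

Definition Frac s r (Ss : S s) : frac := exist _ (s, r) (asboolT Ss).
Definition den (x : frac) : R := (val x).1.
Definition num (x : frac) : R := (val x).2.
Lemma denP (x : frac) : S (den x). Proof. exact: asboolW (svalP x). Qed.

Definition frac_eqv (x y : frac) : bool :=
  `[< exists a b, [/\ S (a * den x), a * den x = b * den y
                    & a * num x = b * num y] >].

Let eqv_common x y a b : frac_eqv x y -> a * den x = b * den y ->
  exists2 t, S t & t * a * num x = t * b * num y.
Proof.
move=> /asboolP[c [d [Sc cd nn]]] ab.
have [p [q [Sp pq]]] := ore (a * den x) Sc.
rewrite !mulrA in pq.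
have [t St tp] := cancel_den (denP x) pq.
have pq' : (t * (p * b)) * den y = (t * (q * d)) * den y.
  by rewrite -!mulrA -cd -ab; rewrite !mulrA in pq tp *; rewrite tp.
have [u Su up] := cancel_den (denP y) pq'.
exists (u * t * p); first by do 2?apply: SM.
transitivity (u * (t * (p * a)) * num x); first by rewrite !mulrA.
rewrite tp -!mulrA nn.
transitivity (u * (t * (q * d)) * num y); first by rewrite !mulrA.
by rewrite -up !mulrA.
Qed.

Lemma frac_eqv_is_equiv : equiv_class_of frac_eqv.
Proof.
have sym x y : frac_eqv x y -> frac_eqv y x.
  by move=> /asboolP[a [b [Sa ab nn]]]; apply/asboolP; exists b, a; rewrite -ab.
split=> [x|x y|y x z].
- by apply/asboolP; exists 1, 1; rewrite mul1r; split=> //; exact: denP.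
- by apply/idP/idP; exact: sym.
move=> xy yz.
have [p [q [Sp pq]]] := ore (den x) (denP y).
have [c [d [Sc cd]]] := ore (p * den x) (denP z).
have xy' : (c * p) * den x = (c * q) * den y by rewrite -!mulrA pq.
have [t St te] := eqv_common xy xy'.
have yz' : (t * (c * q)) * den y = (t * d) * den z.
  by rewrite -!mulrA -cd pq.
have [u Su ue] := eqv_common yz yz'.
apply/asboolP; exists (u * (t * (c * p))), (u * (t * d)); split.
- rewrite -!mulrA; do !apply: SM => //; exact: denP.
- by rewrite -!mulrA -cd.
- by rewrite -ue -!mulrA in te *; rewrite te.
Qed.

Canonical frac_eqv_equiv := EquivRelPack frac_eqv_is_equiv.
Canonical frac_eqv_encModRel := defaultEncModRel frac_eqv.

Definition left_loc : Type := {eq_quot frac_eqv}.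
HB.instance Definition _ := Choice.on left_loc.
HB.instance Definition _ : EqQuotient frac frac_eqv left_loc :=
  EqQuotient.on left_loc.

Definition mkfrac s r (Ss : S s) : left_loc := \pi_left_loc (Frac r Ss).

Lemma mkfracP s r (Ss : S s) s' r' (Ss' : S s') :
  mkfrac r Ss = mkfrac r' Ss' <->
  exists a b, [/\ S (a * s), a * s = b * s' & a * r = b * r'].
Proof.
rewrite /mkfrac; split=> [/eqmodP/asboolP//|h].
by apply/eqmodP/asboolP.
Qed.

Lemma mkfrac_repr u : mkfrac (num (repr u)) (denP (repr u)) = u.
Proof.
rewrite -[RHS]reprK; apply/eqmodP/asboolP; exists 1, 1.
by rewrite !mul1r; split=> //; exact: denP.
Qed.

Lemma mkfrac_common s r (Ss : S s) s' r' (Ss' : S s') a b :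
  mkfrac r Ss = mkfrac r' Ss' -> a * s = b * s' ->
  exists2 t, S t & t * a * r = t * b * r'.
Proof. by move=> /eqmodP h ab; exact: (eqv_common h). Qed.

Lemma mkfrac_expand s r (Ss : S s) a (Sas : S (a * s)) :
  mkfrac r Ss = mkfrac (a * r) Sas.
Proof. by apply/mkfracP; exists a, 1; rewrite !mul1r. Qed.

(* s^-1 r + s'^-1 r' = (a s)^-1 (a r + b r') whenever a s = b s' lies in S, and
   s^-1 r * s'^-1 r' = (t s)^-1 (q r') whenever t r = q s' with t in S; the
   results do not depend on the choices made (loc_addE, loc_mulE). *)
Fact loc_add_subproof (u v : left_loc) : exists w : left_loc,
  exists a b (Sas : S (a * den (repr u))),
    a * den (repr u) = b * den (repr v) /\
    w = mkfrac (a * num (repr u) + b * num (repr v)) Sas.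
Proof.
have [a [b [Sa ab]]] := ore (den (repr u)) (denP (repr v)).
have Sas := SM Sa (denP (repr u)).
by exists (mkfrac (a * num (repr u) + b * num (repr v)) Sas), a, b, Sas.
Qed.
Definition loc_add u v : left_loc := projT1 (cid (loc_add_subproof u v)).

Fact loc_mul_subproof (u v : left_loc) : exists w : left_loc,
  exists t q (Sts : S (t * den (repr u))),
    t * num (repr u) = q * den (repr v) /\ w = mkfrac (q * num (repr v)) Sts.
Proof.
have [t [q [St tq]]] := ore (num (repr u)) (denP (repr v)).
have Sts := SM St (denP (repr u)).
by exists (mkfrac (q * num (repr v)) Sts), t, q, Sts.
Qed.
Definition loc_mul u v : left_loc := projT1 (cid (loc_mul_subproof u v)).

Definition loc_zero : left_loc := mkfrac 0 S1.
Definition loc_one : left_loc := mkfrac 1 S1.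
Definition loc_opp (u : left_loc) : left_loc :=
  mkfrac (- num (repr u)) (denP (repr u)).

Lemma loc_addE s r (Ss : S s) s' r' (Ss' : S s') a b (Sas : S (a * s)) :
  a * s = b * s' ->
  loc_add (mkfrac r Ss) (mkfrac r' Ss') = mkfrac (a * r + b * r') Sas.
Proof.
set u := mkfrac r Ss; set v := mkfrac r' Ss'; move=> ab.
have [c [d [Sc [cd e]]]] := projT2 (cid (loc_add_subproof u v)).
rewrite /loc_add e {e}.
have eu : mkfrac (num (repr u)) (denP (repr u)) = mkfrac r Ss.
  exact: mkfrac_repr.
have ev : mkfrac (num (repr v)) (denP (repr v)) = mkfrac r' Ss'.
  exact: mkfrac_repr.
have [p [q [Sp pq]]] := ore (c * den (repr u)) Sas.
have [|t St te] := @mkfrac_common _ _ _ _ _ _ (p * c) (q * a) eu.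
  by rewrite -!mulrA.
have [|t' St' te'] := @mkfrac_common _ _ _ _ _ _ (t * (p * d)) (t * (q * b)) ev.
  by rewrite -!mulrA -cd -ab pq.
apply/mkfracP; exists (t' * t * p), (t' * t * q); split.
- by rewrite -!mulrA; do !apply: SM => //.
- by rewrite -!mulrA pq.
- rewrite !mulrDr; congr (_ + _); last by rewrite !mulrA in te' *.
  by rewrite -!mulrA; congr (t' * _); rewrite !mulrA in te *.
Qed.

Lemma loc_mulE s r (Ss : S s) s' r' (Ss' : S s') t q (Sts : S (t * s)) :
  t * r = q * s' ->
  loc_mul (mkfrac r Ss) (mkfrac r' Ss') = mkfrac (q * r') Sts.
Proof.
set u := mkfrac r Ss; set v := mkfrac r' Ss'; move=> tq.
have [c [d [Sc [cd e]]]] := projT2 (cid (loc_mul_subproof u v)).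
rewrite /loc_mul e {e}.
have eu : mkfrac (num (repr u)) (denP (repr u)) = mkfrac r Ss.
  exact: mkfrac_repr.
have ev : mkfrac (num (repr v)) (denP (repr v)) = mkfrac r' Ss'.
  exact: mkfrac_repr.
have [x [y [Sx xy]]] := ore (c * den (repr u)) Sts.
have [|w Sw we] := @mkfrac_common _ _ _ _ _ _ (x * c) (y * t) eu.
  by rewrite -!mulrA.
have [|w' Sw' we'] := @mkfrac_common _ _ _ _ _ _ (w * (x * d)) (w * (y * q)) ev.
  by rewrite -!mulrA -cd -tq; rewrite !mulrA in we *.
apply/mkfracP; exists (w' * w * x), (w' * w * y); split.
- by rewrite -!mulrA; do !apply: SM => //.
- by rewrite -!mulrA xy.
- by rewrite !mulrA in we' *.
Qed.

Lemma loc_oppE s r (Ss : S s) : loc_opp (mkfrac r Ss) = mkfrac (- r) Ss.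
Proof.
rewrite /loc_opp; set u := mkfrac r Ss.
have /mkfracP[a [b [Sa ab nn]]] := mkfrac_repr u.
by apply/mkfracP; exists a, b; rewrite !mulrN nn.
Qed.

Lemma mkfracW (P : left_loc -> Prop) :
  (forall s r (Ss : S s), P (mkfrac r Ss)) -> forall u, P u.
Proof. by move=> h u; rewrite -[u]mkfrac_repr. Qed.

Lemma mkfrac_irr s r (Ss Ss' : S s) : mkfrac r Ss = mkfrac r Ss'.
Proof. by rewrite (Prop_irrelevance Ss Ss'). Qed.

Lemma mkfrac_eq s s' r r' (Ss : S s) (Ss' : S s') :
  s = s' -> r = r' -> mkfrac r Ss = mkfrac r' Ss'.
Proof. by move=> es er; subst; exact: mkfrac_irr. Qed.

Lemma mkfracD s (Ss : S s) r r' :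
  loc_add (mkfrac r Ss) (mkfrac r' Ss) = mkfrac (r + r') Ss.
Proof.
have S1s : S (1 * s) by rewrite mul1r.
by rewrite (@loc_addE _ _ _ _ _ _ 1 1 S1s) //; apply: mkfrac_eq; rewrite !mul1r.
Qed.

Lemma common_den2 u v : exists s (Ss : S s) r r',
  u = mkfrac r Ss /\ v = mkfrac r' Ss.
Proof.
elim/mkfracW: u => s r Ss; elim/mkfracW: v => s' r' Ss'.
have [a [b [Sa ab]]] := ore s Ss'.
have Sas : S (a * s) by exact: SM.
have Sbs : S (b * s') by rewrite -ab.
exists (a * s), Sas, (a * r), (b * r').
split; first exact: mkfrac_expand.
by rewrite (mkfrac_expand r' Ss' Sbs); apply: mkfrac_eq.
Qed.

Lemma common_den3 u v w : exists s (Ss : S s) r r' r'',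
  [/\ u = mkfrac r Ss, v = mkfrac r' Ss & w = mkfrac r'' Ss].
Proof.
have [s [Ss [r [r' [-> ->]]]]] := common_den2 u v.
elim/mkfracW: w => s' r'' Ss'.
have [a [b [Sa ab]]] := ore s Ss'.
have Sas : S (a * s) by exact: SM.
have Sbs : S (b * s') by rewrite -ab.
exists (a * s), Sas, (a * r), (a * r'), (b * r''); split.
- exact: mkfrac_expand.
- exact: mkfrac_expand.
- by rewrite (mkfrac_expand r'' Ss' Sbs); apply: mkfrac_eq.
Qed.

Lemma mkfrac0 s (Ss : S s) : mkfrac 0 Ss = loc_zero.
Proof. by apply/mkfracP; exists 1, s; rewrite !mulr0 mulr1 mul1r. Qed.

Lemma loc_addA : associative loc_add.
Proof.
move=> u v w; have [s [Ss [a [b [c [-> -> ->]]]]]] := common_den3 u v w.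
by rewrite !mkfracD addrA.
Qed.
Lemma loc_addC : commutative loc_add.
Proof.
move=> u v; have [s [Ss [a [b [-> ->]]]]] := common_den2 u v.
by rewrite !mkfracD addrC.
Qed.
Lemma loc_add0 : left_id loc_zero loc_add.
Proof. by elim/mkfracW=> s r Ss; rewrite -(mkfrac0 Ss) mkfracD add0r. Qed.
Lemma loc_addN : left_inverse loc_zero loc_opp loc_add.
Proof. by elim/mkfracW=> s r Ss; rewrite loc_oppE mkfracD addNr mkfrac0. Qed.

Lemma loc_mulA : associative loc_mul.
Proof.
elim/mkfracW=> s a Ss; elim/mkfracW=> t b St; elim/mkfracW=> u c Su.
have [u' [b' [Su' ub]]] := ore b Su.
have Su't : S (u' * t) by exact: SM.
have [v [e [Sv ve]]] := ore a Su't.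
have Svs : S (v * s) by exact: SM.
have S1vs : S (1 * (v * s)) by rewrite mul1r.
rewrite (@loc_mulE _ _ _ _ _ _ _ _ Su't ub) (@loc_mulE _ _ _ _ _ _ _ _ Svs ve).
rewrite (@loc_mulE _ _ _ _ _ _ v (e * u') Svs); last by rewrite ve mulrA.
rewrite (@loc_mulE _ _ _ _ _ _ 1 (e * b') S1vs).
  by apply: mkfrac_eq; rewrite ?mul1r ?mulrA.
by rewrite mul1r -!mulrA ub.
Qed.
Lemma loc_mul1l : left_id loc_one loc_mul.
Proof.
elim/mkfracW=> s r Ss; have Ss1 : S (s * 1) by rewrite mulr1.
rewrite (@loc_mulE _ _ _ _ _ _ s 1 Ss1) ?mulr1 ?mul1r //.
by apply: mkfrac_eq; rewrite ?mulr1.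
Qed.
Lemma loc_mul1r : right_id loc_one loc_mul.
Proof.
elim/mkfracW=> s r Ss; have S1s : S (1 * s) by rewrite mul1r.
rewrite (@loc_mulE _ _ _ _ _ _ 1 r S1s) ?mulr1 ?mul1r //.
by apply: mkfrac_eq; rewrite ?mul1r.
Qed.
Lemma loc_mulDl : left_distributive loc_mul loc_add.
Proof.
move=> u v w; have [s [Ss [a [b [-> ->]]]]] := common_den2 u v.
elim/mkfracW: w => t c St; rewrite mkfracD.
have [p [a' [Sp pa]]] := ore a St.
have [q [b' [Sq qb]]] := ore (p * b) St.
have Sqps : S (q * p * s) by rewrite -mulrA; do !apply: SM.
have ea : q * p * a = q * a' * t by rewrite -!mulrA pa.
have eb : q * p * b = b' * t by rewrite -mulrA qb.
rewrite (@loc_mulE _ _ _ _ _ _ _ _ Sqps ea) (@loc_mulE _ _ _ _ _ _ _ _ Sqps eb).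
rewrite (@loc_mulE _ _ _ _ _ _ _ (q * a' + b') Sqps).
  by rewrite mkfracD mulrDl.
by rewrite mulrDr ea eb mulrDl.
Qed.
Lemma loc_mulDr : right_distributive loc_mul loc_add.
Proof.
move=> u v w; have [t [St [b [c [-> ->]]]]] := common_den2 v w.
elim/mkfracW: u => s a Ss; rewrite mkfracD.
have [p [q [Sp pq]]] := ore a St.
have Sps : S (p * s) by exact: SM.
by rewrite !(@loc_mulE _ _ _ _ _ _ _ _ Sps pq) mkfracD mulrDr.
Qed.
Lemma loc_one_neq0 : loc_one != loc_zero.
Proof.
apply/eqP => /mkfracP[a [b]]; rewrite !mulr1 mulr0 => -[Sa _ a0].
by apply: S0; rewrite -a0.
Qed.

HB.instance Definition _ := GRing.isZmodule.Build left_loc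
  loc_addA loc_addC loc_add0 loc_addN.
HB.instance Definition _ := GRing.Zmodule_isNzRing.Build left_loc
  loc_mulA loc_mul1l loc_mul1r loc_mulDl loc_mulDr loc_one_neq0.

End LeftLocalization.

Definition left_quotient_ring (A : nzRingType) (h : left_ore_set (regular A)) :
  nzRingType := left_loc (regular_left_den h).

Section LocalizationRadical.
Variable R : nzRingType.

Lemma ass_two_sided_ideal (S : set R) :
  left_den_set S -> two_sided_ideal (ass S).
Proof.
move=> [[[S1 _ SM] ore] _]; split; [split|].
- by exists 1 => //; rewrite mulr0.
- move=> x y [s Ss sx] [t St ty]; have [p [q [Sp pq]]] := ore s _ St.
  exists (p * s); first exact: SM.
  by rewrite mulrDr -mulrA sx mulr0 pq -mulrA ty mulr0 addr0.
- move=> a x [s Ss sx]; have [p [q [Sp pq]]] := ore a _ Ss.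
  by exists p => //; rewrite mulrA pq -mulrA sx mulr0.
- by move=> a x [s Ss sx]; exists s => //; rewrite mulrA sx mul0r.
Qed.

Lemma ass_proper (S : set R) : left_den_set S -> ~ ass S 1.
Proof. by move=> [[[_ S0 _] _] _] [s Ss]; rewrite mulr1 => s0; rewrite s0 in Ss. Qed.

Lemma left_den_set1 : left_den_set [set 1 : R].
Proof.
split; [split; [split|]|] => //.
- by move=> /esym/eqP; rewrite oner_eq0.
- by move=> s t -> ->; rewrite /= mulr1.
- by move=> r s ->; exists 1, r; rewrite mul1r mulr1.
- by move=> r s -> r0; exists 1 => //; rewrite mul1r -[r]mulr1.
Qed.

Lemma max_den_neq0 : max_den R !=set0.
Proof.
pose P (S : set R) := S = set0 \/ left_den_set S.
have [F FP Ftot|S [PS maxS]] := @Zorn_bigcup R P.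
  have [[S0 [FS0 dS0]]|noden] :=
      pselect (exists S0, F S0 /\ left_den_set S0); last first.
    left; rewrite -subset0 => x [S FS Sx]; exfalso.
    case: (FP _ FS) => [e|dS]; first by rewrite e in Sx.
    by apply: noden; exists S.
  have den S x : F S -> S x -> left_den_set S.
    by move=> FS Sx; case: (FP _ FS) => // e; rewrite e in Sx.
  right; split; [split; [split|]|].
  - by exists S0 => //; case: dS0 => -[[]].
  - by move=> [S FS Sx]; have [[[_ + _] _] _] := den _ _ FS Sx; exact.
  - move=> s t [S FS Ss] [T FT Tt].
    have [[[_ _ SM] _] _] := den _ _ FS Ss.
    have [[[_ _ TM] _] _] := den _ _ FT Tt.
    have [ST|TS] := Ftot _ _ FS FT.
      by exists T => //; apply: TM => //; exact: ST.
    by exists S => //; apply: SM => //; exact: TS.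
  - move=> r s [S FS Ss]; have [[_ ore] _] := den _ _ FS Ss.
    by have [t [q [St e]]] := ore r s Ss; exists t, q; split=> //; exists S.
  - move=> r s [S FS Ss] rs0; have [_ canc] := den _ _ FS Ss.
    by have [t St tr] := canc r s Ss rs0; exists t => //; exists S.
have dS : left_den_set S.
  case: PS => // S0; exfalso; apply: (maxS [set 1]); last by right; exact: left_den_set1.
  by rewrite S0; split=> // /(_ 1) /(_ erefl).
exists S; split=> // T dT ST; apply/seteqP; split=> //.
by apply: contrapT => nTS; apply: (maxS T); [split | right].
Qed.

Definition localization_radical_set : set R :=
  \bigcap_(S in max_den R) ass S.

Fact localization_radical_ideal : two_sided_ideal localization_radical_set.
Proof.
have assI S : max_den R S -> two_sided_ideal (ass S).
  by move=> [dS _]; exact: ass_two_sided_ideal.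
split; [split|].
- by move=> S /assI[[]].
- move=> x y hx hy S mS; have [[_ aD _] _] := assI _ mS.
  by apply: aD; [exact: hx | exact: hy].
- move=> a x hx S mS; have [[_ _ aM] _] := assI _ mS; exact/aM/hx.
- move=> a x hx S mS; have [_ aM] := assI _ mS; exact/aM/hx.
Qed.

Fact localization_radical_proper : ~ localization_radical_set 1.
Proof.
have [S mS] := max_den_neq0; have dS := mS.1.
by move=> /(_ S mS); exact: ass_proper.
Qed.

Definition localization_radical : properIdeal R :=
  ProperIdeal localization_radical_ideal localization_radical_proper.

Definition min_primes (I : set R) : set (properIdeal R) :=
  [set p | [/\ prime_ideal p, I `<=` p &
     forall q : set R, prime_ideal q -> I `<=` q -> q `<=` p -> q = p]].

Definition regular_mod (p : properIdeal R) : set R :=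
  quot_pi p @^-1` regular (quot_ring p).

End LocalizationRadical.
Arguments localization_radical R : clear implicits.
Arguments min_primes R I : clear implicits.

(* Main.v *)
(* Let [A] be [R/l].  By Goldie's theorem (1) says that [A] is semiprime left
   Goldie, and then its maximal annihilator ideals are finitely many primes [q_i]
   with intersection 0 and left Goldie quotients.  Conversely, let [l] be a finite
   intersection of incomparable primes [p_i] with every [R/p_i] left Goldie.  For
   each [i] some [d_i] lies in all [p_j], [j <> i], and is regular modulo [p_i];
   gluing with the [d_i] gives Goldie's conditions for [R/l].  If [S] is a left
   denominator set with [l <= ass S], then [ass S <= p_i] for some [i], since
   otherwise [ass S] contains an element regular modulo [l].  Multiplying by [d_i]
   shows that [S] is contained in [S_(p_i)] and that [S_(p_i)] is a left denominator
   set with [ass S_(p_i) = p_i].  Hence every maximal denominator set is some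
   [S_(p_i)]; all of them occur, because otherwise some [d_i] would lie in
   [l <= p_i]. *)
From HB Require Import structures.
Require Import Defs.
From mathcomp Require Import all_boot all_algebra.
From mathcomp Require Import boolp classical_sets functions cardinality.

Set Implicit Arguments.
Unset Strict Implicit.
Unset Printing Implicit Defensive.

Import GRing.Theory.

Local Open Scope classical_set_scope.
Local Open Scope ring_scope.

(** * Semisimple rings *)





(** Goldie's conditions are restated on subsets of R ([goldie_modulo]), so that gluing over the
    primes takes place in R and the quotient rings enter only at both ends. The obstacle is the Ore
    condition in R: a relation t r = q s modulo p_i must become an equality, which requires killing
    given elements of p_i by elements regular modulo p_i. Multiplication by d_i moves p_i into l,
    but l need not be zero in R and has to be killed in turn; this is why the argument starts from a
    set S with l contained in ass S. In R the maximal denominator sets have this property by the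
    definition of l. In R/l, where l becomes 0, every denominator set has it. One analysis therefore
    serves both rings, and comparing its two outcomes gives the bijection of maximal denominator
    sets. On the way from a simple Artinian localization back to Goldie's conditions, only the image
    of S in R / ass S is known to become invertible; hence fractions are studied for denominators
    that need not exhaust the regular elements. *)

Section LeftIdeals.
Variable B : nzRingType.
Implicit Types (L K M : set B) (x y z : B).

Lemma left_idealN L x : left_ideal L -> L x -> L (- x).
Proof. by move=> [_ _ LM] Lx; rewrite -mulN1r; exact: LM. Qed.

Lemma left_idealB L x y : left_ideal L -> L x -> L y -> L (x - y).
Proof. by move=> lL Lx Ly; case: (lL) => _ LD _; apply: LD => //; exact: left_idealN. Qed.

Lemma left_ideal_sum L n (F : 'I_n -> B) :
  left_ideal L -> (forall i, L (F i)) -> L (\sum_i F i).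
Proof. by move=> [L0 LD _] LF; elim/big_ind: _. Qed.

Lemma left_ideal0 : left_ideal [set 0 : B].
Proof.
by split=> // [x y -> ->|a x ->] /=; rewrite ?addr0 ?mulr0.
Qed.

Definition sum_set L K : set B := [set z | exists x y, [/\ L x, K y & z = x + y]].

Lemma left_ideal_sum_set L K : left_ideal L -> left_ideal K -> left_ideal (sum_set L K).
Proof.
move=> [L0 LD LM] [K0 KD KM]; split.
- by exists 0, 0; rewrite addr0.
- move=> _ _ [x [y [Lx Ky ->]]] [x' [y' [Lx' Ky' ->]]].
  by exists (x + x'), (y + y'); rewrite addrACA; split; [exact: LD|exact: KD|].
- move=> a _ [x [y [Lx Ky ->]]].
  by exists (a * x), (a * y); rewrite mulrDr; split; [exact: LM|exact: KM|].
Qed.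

Definition principal x : set B := [set z | exists r, z = r * x].

Lemma left_ideal_principal x : left_ideal (principal x).
Proof.
split; first by exists 0; rewrite mul0r.
  by move=> _ _ [r ->] [s ->]; exists (r + s); rewrite mulrDl.
by move=> a _ [r ->]; exists (a * r); rewrite mulrA.
Qed.

Lemma principal_refl x : principal x x.
Proof. by exists 1; rewrite mul1r. Qed.

Lemma left_ideal_neq0P L : left_ideal L -> L != [set 0] <-> exists2 x, L x & x != 0.
Proof.
move=> [L0 _ _]; split=> [/eqP nL|[x Lx /eqP x0]]; last first.
  by apply/eqP => eL; apply: x0; rewrite eL in Lx.
apply: contrapT => h; apply: nL; apply/seteqP; split=> [x Lx|_ ->//].
by apply: contrapT => /eqP x0; apply: h; exists x.
Qed.

Definition finite_sums (X : set B) : set B :=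
  [set x | exists (n : nat) (y : 'I_n -> B), (forall i, X (y i)) /\ x = \sum_i y i].

Lemma left_ideal_finite_sums (X : set B) :
  (forall a x, X x -> X (a * x)) -> left_ideal (finite_sums X).
Proof.
move=> XM; split.
- by exists 0%N, (fun=> 0); rewrite big_ord0; split=> // -[].
- move=> _ _ [m [y [my ->]]] [n [z [mz ->]]].
  exists (m + n)%N, (fun i : 'I_(m + n) =>
    match fintype.split i with inl j => y j | inr j => z j end).
  split; first by move=> i; case: (fintype.split i).
  rewrite big_split_ord /=; congr (_ + _); apply: eq_bigr => i _.
    by rewrite (unsplitK (inl i)).
  by rewrite (unsplitK (inr i)).
- move=> a _ [n [y [my ->]]]; exists n, (fun i => a * y i).
  by rewrite mulr_sumr; split=> // i; exact: XM.
Qed.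

(* For a left ideal [L]: every nonzero [Ay] meets [L] nontrivially. *)
Definition essential L : Prop := forall y, y != 0 -> exists2 r, r * y != 0 & L (r * y).

Lemma essential_colon L x : left_ideal L -> essential L -> essential [set r | L (r * x)].
Proof.
move=> [L0 _ LM] eL y y0; have [yx0|yx0] := eqVneq (y * x) 0.
  by exists 1; rewrite /= mul1r ?yx0.
have [r ryx Lryx] := eL _ yx0; exists r; last by rewrite /= -mulrA.
by apply: contraNneq ryx => ry0; rewrite mulrA ry0 mul0r.
Qed.

Lemma left_ideal_colon L x : left_ideal L -> left_ideal [set r | L (r * x)].
Proof.
move=> [L0 LD LM]; split; rewrite /= ?mul0r //.
  by move=> a b La Lb; rewrite mulrDl; exact: LD.
by move=> a b Lb; rewrite -mulrA; exact: LM.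
Qed.

End LeftIdeals.

Section SemisimpleRings.
Variable B : nzRingType.
Implicit Types (L K M : set B) (x y z : B).

(* Every left ideal is a direct summand; the working form of semisimplicity. *)
Definition left_semisimple : Prop :=
  forall L, left_ideal L -> exists2 e, L e & forall x, L x -> x * e = x.

Lemma minimal_ideals_complement L n (y : 'I_n -> B) (M : 'I_n -> set B) :
  left_ideal L ->
  (forall i, M i (y i) /\ (minimal_left_ideal (M i) \/ M i = [set 0])) ->
  exists K, [/\ left_ideal K, L `&` K `<=` [set 0]
              & forall i, sum_set K L (y i)].
Proof.
move=> lL; elim: n => [|n IHn] in y M * => hM.
  exists [set 0]; split; [exact: left_ideal0|by move=> ? []|by case].
have [K [lK LK0 yK]] := IHn (fun i => y (lift ord0 i)) _ (fun i => hM (lift ord0 i)).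
have [L0 _ _] := lL; have [K0 _ _] := lK.
have [My mM] := hM ord0.
have [yin|ynotin] := pselect (sum_set K L (y ord0)).
  exists K; split=> // i; case: (unliftP ord0 i) => [j ->|->//]; exact: yK.
have [] : minimal_left_ideal (M ord0).
  case: mM => // M0; case: ynotin; move: My; rewrite M0 => ->.
  by exists 0, 0; rewrite addr0.
move=> lM _ minM.
have lKL := left_ideal_sum_set lK lL.
have MKL0 z : M ord0 z -> sum_set K L z -> z = 0.
  move=> Mz Kz; pose M' := M ord0 `&` sum_set K L.
  have lM' : left_ideal M'.
    case: lM => M0 MD MM; case: lKL => S0 SD SM; split; first by split.
      by move=> a b [? ?] [? ?]; split; [exact: MD|exact: SD].
    by move=> a b [? ?]; split; [exact: MM|exact: SM].
  case: (minM M' lM' (@subIsetl _ _ _)) => eM; first by have : M' z by []; rewrite eM.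
  by case: ynotin; move: My; rewrite -eM => -[].
exists (sum_set K (M ord0)); split; first exact: left_ideal_sum_set.
  move=> z [Lz [k [m [Kk Mm zE]]]].
  have m0 : m = 0.
    apply: MKL0 => //; exists (- k), z; split=> //; first exact: left_idealN.
    by rewrite zE addKr.
  by apply: LK0; split=> //; rewrite zE m0 addr0.
move=> i; case: (unliftP ord0 i) => [j ->|->].
  have [k [l [Kk Ll ->]]] := yK j; exists k, l; split=> //.
  by exists k, 0; rewrite addr0; split=> //; case: lM.
exists (y ord0), 0; rewrite addr0; split=> //.
by exists 0, (y ord0); rewrite add0r.
Qed.

(** The required e is the L-component of 1 = f + e: for x in L, x - x e = x f lies in both L and
    K. *)
Lemma left_semisimple_complement :
  (forall L, left_ideal L -> exists K, [/\ left_ideal K, L `&` K `<=` [set 0]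
     & sum_set K L 1]) -> left_semisimple.
Proof.
move=> cB L lL; have [K [lK LK0 [f [e [Kf Le fe]]]]] := cB L lL.
exists e => // x Lx; have xE : x - x * e = x * f.
  by rewrite -{1}[x]mulr1 fe mulrDr addrK.
apply/esym/eqP; rewrite -subr_eq0; apply/eqP/LK0; split.
  by apply: left_idealB => //; case: lL => _ _; exact.
by rewrite xE; case: lK => _ _; exact.
Qed.

Lemma semisimple_sum_minimal n (y : 'I_n -> B) (M : 'I_n -> set B) :
  (forall i, M i (y i) /\ (minimal_left_ideal (M i) \/ M i = [set 0])) ->
  1 = \sum_i y i -> left_semisimple.
Proof.
move=> hM y1; apply: left_semisimple_complement => L lL.
have [K [lK LK0 yK]] := minimal_ideals_complement lL hM.
exists K; split=> //; rewrite y1.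
by apply: left_ideal_sum => //; exact: left_ideal_sum_set.
Qed.

Lemma semisimple_artinian_left_semisimple : semisimple_artinian B -> left_semisimple.
Proof.
move=> [_ /(_ 1)[n [y [my y1]]]].
have my' i : exists M, minimal_left_ideal M /\ M (y i) by have [L] := my i; exists L.
have [M hM] := choice my'.
by apply: (@semisimple_sum_minimal n y M) => // i; have [] := hM i; split=> //; left.
Qed.

(** If K is maximal among the left ideals meeting L in 0, then K + L is essential, hence contains
    1. *)
Lemma left_semisimple_essential :
  (forall L, left_ideal L -> essential L -> L 1) -> left_semisimple.
Proof.
move=> eB; apply: left_semisimple_complement => L lL.
have [L0 LD LM] := lL.
(* [K 0] is left out so that the union of an empty chain satisfies [P]; maximality restores it. *)
pose P K := [/\ forall x y, K x -> K y -> K (x + y), forall a x, K x -> K (a * x)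
              & L `&` K `<=` [set 0]].
have [F FP Ftot|K [[KD KM LK0] maxK]] := @Zorn_bigcup B P.
  split.
  - move=> x y [U FU Ux] [V FV Vy].
    have [UD _ _] := FP _ FU; have [VD _ _] := FP _ FV.
    have [UV|VU] := Ftot _ _ FU FV; first by exists V => //; apply: VD => //; exact: UV.
    by exists U => //; apply: UD => //; exact: VU.
  - by move=> a x [U FU Ux]; exists U => //; have [_ + _] := FP _ FU; exact.
  - by move=> x [Lx [U FU Ux]]; have [_ _] := FP _ FU; apply.
have K0 : K 0.
  apply: contrapT => nK0; apply: (maxK [set 0]); last first.
    by split; [move=> x y -> ->; rewrite addr0|move=> a x ->; rewrite mulr0|move=> x []].
  split=> [x Kx|/(_ 0 erefl)//].
  by case: nK0; rewrite -(mul0r x); exact: KM.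
have lK : left_ideal K by [].
have lKL := left_ideal_sum_set lK lL.
exists K; split=> //; apply: eB => // y y0.
apply: contrapT => nr.
have ry0 r : sum_set K L (r * y) -> r * y = 0.
  by move=> h; apply/eqP; apply: contrapT => /negP ry; apply: nr; exists r.
have lyK := left_ideal_sum_set lK (left_ideal_principal y).
apply: (maxK (sum_set K (principal y))).
  split; first by move=> k Kk; exists k, 0; rewrite addr0; split=> //; exists 0; rewrite mul0r.
  move=> /(_ y) hy; have Ky : K y.
    by apply: hy; exists 0, y; rewrite add0r; split=> //; exact: principal_refl.
  have := ry0 1; rewrite mul1r => h; move: y0; rewrite h ?eqxx //.
  by exists y, 0; rewrite addr0.
case: lyK => _ HD HM; split=> //.
move=> z [Lz [k [_ [Kk [r ->] zE]]]].
have r0 : r * y = 0.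
  apply: ry0; exists (- k), z; split=> //; first exact: left_idealN.
  by rewrite zE addKr.
by apply: LK0; split=> //; rewrite zE r0 addr0.
Qed.

Lemma left_semisimple_acc (L : nat -> set B) : left_semisimple ->
  (forall n, left_ideal (L n)) -> (forall n, L n `<=` L n.+1) ->
  exists N, forall n, L n `<=` L N.
Proof.
move=> ssB lL sL.
have mono m n : (m <= n)%N -> L m `<=` L n.
  move=> /subnK <-; elim: (n - m)%N => [|k IH] //.
  by rewrite addSn; exact: subset_trans IH (sL _).
have lU : left_ideal (\bigcup_n L n).
  split; first by exists 0%N => //; case: (lL 0%N).
    move=> x y [m _ Lx] [n _ Ly]; exists (maxn m n) => //.
    case: (lL (maxn m n)) => _ LD _; apply: LD.
      by apply: mono Lx; exact: leq_maxl.
    by apply: mono Ly; exact: leq_maxr.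
  by move=> a x [n _ Lx]; exists n => //; case: (lL n) => _ _; exact.
have [e [N _ Le] he] := ssB _ lU.
exists N => n x Lx; rewrite -(he x); last by exists n.
by case: (lL N) => _ _; exact.
Qed.

(** The descending chain is turned into an ascending one: compatible idempotents generating the
    [L n] have increasing left annihilators. *)
Lemma left_semisimple_artinian : left_semisimple -> left_artinian B.
Proof.
move=> ssB L lL sL.
have [e0 Le0 he0] := ssB _ (lL 0%N).
have step (n : nat) (f : B) : exists f', (L n f /\ forall x, L n x -> x * f = x) ->
    [/\ L n.+1 f', forall x, L n.+1 x -> x * f' = x & f * f' = f'].
  (* The left factor f gives f f' = f', the compatibility that makes the annihilators [K n] below
     increase. *)
  have [e Le he] := ssB _ (lL n.+1); exists (f * e) => -[Lf hf]; split.
  - by case: (lL n.+1) => _ _; exact.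
  - by move=> x Lx; rewrite mulrA hf ?he //; exact: sL.
  - by rewrite mulrA hf.
have [g gP] := choice (fun nf : nat * B => step nf.1 nf.2).
pose f := fix f n := if n is m.+1 then g (m, f m) else e0.
have fP n : L n (f n) /\ forall x, L n x -> x * f n = x.
  by elim: n => [|n IH] //=; have [] := gP (n, f n) IH.
have fS n : f n * f n.+1 = f n.+1 by have [] := gP (n, f n) (fP n).
have idf n : f n * f n = f n by have [Lf] := fP n; exact.
have fSr n : f n.+1 * f n = f n.+1.
  by have [_] := fP n; apply; apply: sL; have [] := fP n.+1.
pose K n := [set x | x * f n = 0].
have [N KN] : exists N, forall n, K n `<=` K N.
  apply: left_semisimple_acc => // n.
    split; rewrite /K /= ?mul0r //; first by move=> x y /= ex ey; rewrite mulrDl ex ey addr0.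
    by move=> a x /= ex; rewrite -mulrA ex mulr0.
  by move=> x ex; change (x * f n.+1 = 0); rewrite -fS mulrA ex mul0r.
exists N => n leNn.
have mono m : L (m + N)%N `<=` L N.
  by elim: m => [|m IH] //; rewrite addSn; exact: subset_trans (sL _) IH.
apply/seteqP; split=> [x Lx|x Lx]; first by apply: (mono (n - N)%N); rewrite subnK.
have : K N (x - x * f n).
  by apply: (KN n); rewrite /K /= mulrBl -mulrA idf subrr.
rewrite /K /= mulrBl; have [_ hN] := fP N; have [Lfn hn] := fP n.
rewrite hN // hN => [/subr0_eq ->|]; first by case: (lL n) => _ _; exact.
case: (lL N) => _ _ LM; apply: LM; apply: (mono (n - N)%N); by rewrite subnK.
Qed.

Lemma left_artinian_minimal L : left_artinian B -> left_ideal L -> L != [set 0] ->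
  exists2 M, minimal_left_ideal M & M `<=` L.
Proof.
move=> aB lL nL; apply: contrapT => noM.
pose T := {K : set B | [/\ left_ideal K, K != [set 0] & K `<=` L]}.
have step (K : T) : {K' : T | sval K' `<=` sval K /\ sval K' <> sval K}.
  apply: cid; case: K => K [lK nK KL]; apply: contrapT => h; apply: noM; exists K => //.
  split=> // K' lK' K'K; have [->|nK'] := pselect (K' = [set 0]); first by left.
  right; apply: contrapT => KK'; apply: h.
  have PK' : [/\ left_ideal K', K' != [set 0] & K' `<=` L].
    by split=> //; [exact/eqP|exact: subset_trans K'K KL].
  by exists (exist _ K' PK').
have [f [_ fP]] := dependent_choice step (exist _ L (And3 lL nL (@subset_refl _ L))).
have [N hN] := aB (fun n => sval (f n)) (fun n => let: And3 h _ _ := svalP (f n) in h)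
  (fun n => (fP n).1).
by apply: (fP N).2; rewrite hN.
Qed.

(** If the generator e of the socle were not 1, the left annihilator of e would contain a minimal
    left ideal; lying in the socle, it would be both fixed and killed by right multiplication by
    e. *)
Lemma left_semisimple_semisimple_artinian : left_semisimple -> semisimple_artinian B.
Proof.
move=> ssB; have aB := left_semisimple_artinian ssB; split=> // x.
pose Soc := finite_sums [set z : B | exists2 L, minimal_left_ideal L & L z].
have lSoc : left_ideal Soc.
  apply: left_ideal_finite_sums => a z [L mL Lz]; exists L => //.
  by case: mL => -[_ _ LM] _ _; exact: LM.
have [e Se he] := ssB _ lSoc.
suff e1 : e = 1 by case: lSoc => _ _ SM; rewrite -(mulr1 x) -e1; exact: (SM x e Se).
apply: contrapT => /eqP ne1.
pose K := [set x | x * e = 0].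
have lK : left_ideal K.
  split; rewrite /K /= ?mul0r //; first by move=> a b /= ea eb; rewrite mulrDl ea eb addr0.
  by move=> a b /= eb; rewrite -mulrA eb mulr0.
have [|M mM MK] := left_artinian_minimal aB lK.
  apply/left_ideal_neq0P => //; exists (1 - e); last by rewrite subr_eq0 eq_sym.
  by rewrite /K /= mulrBl mul1r he ?subrr.
have [lM nM _] := mM; have [z Mz z0] := (left_ideal_neq0P lM).1 nM.
have : z * e = z.
  by apply: he; exists 1%N, (fun=> z); rewrite big_ord1; split=> // _; exists M.
by rewrite (MK z Mz) => /esym/eqP; rewrite (negPf z0).
Qed.

(** The translates M b of a minimal left ideal are minimal or zero, and their sum is a nonzero
    two-sided ideal, hence contains 1. *)
Lemma simple_artinian_left_semisimple : simple_left_artinian B -> left_semisimple.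
Proof.
move=> [sB aB].
have lT : left_ideal [set: B] by [].
have [|M mM _] := left_artinian_minimal aB lT.
  by apply/left_ideal_neq0P => //; exists 1 => //; exact: oner_neq0.
have [lM nM minM] := mM; have [m Mm m0] := (left_ideal_neq0P lM).1 nM.
pose Mb b := [set z | exists2 x, M x & z = x * b].
have lMb b : left_ideal (Mb b).
  case: lM => M0 MD MM; split; first by exists 0; rewrite ?mul0r.
    by move=> _ _ [x Mx ->] [y My ->]; exists (x + y); rewrite ?mulrDl //; exact: MD.
  by move=> a _ [x Mx ->]; exists (a * x); rewrite ?mulrA //; exact: MM.
have mMb b : minimal_left_ideal (Mb b) \/ Mb b = [set 0].
  have [->|nMb] := eqVneq (Mb b) [set 0]; [by right|left; split=> // L lL LMb].
  pose M' := [set x | M x /\ L (x * b)].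
  have lM' : left_ideal M'.
    case: lM => M0 MD MM; case: (lL) => L0 LD LM; split.
    - by split=> //; rewrite mul0r.
    - by move=> x y [? ?] [? ?]; split; [exact: MD|rewrite mulrDl; exact: LD].
    - by move=> a x [? ?]; split; [exact: MM|rewrite -mulrA; exact: LM].
  have [M'0|M'M] := minM M' lM' (fun x h => h.1); [left|right].
    apply/seteqP; split=> [z Lz|_ ->]; last by case: lL.
    have [x Mx zE] := LMb z Lz.
    have : M' x by split; rewrite -?zE.
    by rewrite M'0 zE => ->; rewrite mul0r.
  apply/seteqP; split=> // _ [x Mx ->].
  by move: Mx; rewrite -M'M => -[].
pose I := finite_sums [set z | exists b, Mb b z].
have tI : two_sided_ideal I.
  split.
    by apply: left_ideal_finite_sums => a z [b Mz]; exists b; case: (lMb b) => _ _; exact.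
  move=> a _ [n [y [my ->]]]; exists n, (fun i => y i * a); rewrite mulr_suml; split=> // i.
  have [b [x Mx ->]] := my i; exists (b * a); exists x => //.
  by rewrite mulrA.
have Im : I m.
  exists 1%N, (fun=> m); rewrite big_ord1; split=> // _; exists 1, m => //.
  by rewrite mulr1.
have [I0|IT] := sB I tI; first by move: m0; rewrite (_ : m = 0) ?eqxx //; rewrite I0 in Im.
have : I 1 by rewrite IT.
move=> [n [y [my y1]]].
have [b hb] := choice my.
by apply: (@semisimple_sum_minimal n y (fun i => Mb (b i))).
Qed.

End SemisimpleRings.

(** * Goldie's theorem *)

Section UniformDimension.
Variable A : nzRingType.
Implicit Types (L : set A) (a x y z r : A).

(** Independence of the left ideals A a_n in terms of elements, since the sequences below are built
    one element at a time. *)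
Definition independent_elements (a : nat -> A) : Prop :=
  forall n (r : nat -> A), \sum_(i < n) r i * a i = 0 ->
    forall i, (i < n)%N -> r i * a i = 0.

Definition finite_udim : Prop :=
  forall a : nat -> A, (forall n, a n != 0) -> ~ independent_elements a.

Lemma finite_udimP : finite_udim <->
  ~ exists L : nat -> set A,
      (forall n, left_ideal (L n) /\ L n != [set 0]) /\ independent_left_ideals L.
Proof.
split=> [fA [L [hL iL]]|nL a a0 ia].
  have hx n : exists x, L n x /\ x != 0.
    by have [lL nL] := hL n; have [x] := (left_ideal_neq0P lL).1 nL; exists x.
  have [a aP] := choice hx.
  apply: (fA a) => [n|n r r0 i lin]; first by have [] := aP n.
  apply: (iL n (fun i : 'I_n => r i * a i) _ r0 (Ordinal lin)) => j.
  by have [[_ _ LM] _] := hL j; apply: LM; have [] := aP j.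
apply: nL; exists (fun n => principal (a n)); split.
  move=> n; split; first exact: left_ideal_principal.
  by apply/(left_ideal_neq0P (left_ideal_principal (a n))); exists (a n) => //; exact: principal_refl.
move=> n x hx x0 i.
have hr (j : nat) : exists r, forall h : (j < n)%N, x (Ordinal h) = r * a j.
  have [h|h] := pselect (j < n)%N; last by exists 0 => h'; case: h.
  have [r xr] := hx (Ordinal h); exists r => h'.
  by rewrite (bool_irrelevance h' h).
have [r rP] := choice hr.
have xE (j : 'I_n) : x j = r j * a j by rewrite -(rP j (ltn_ord j)); congr x; exact: val_inj.
by rewrite xE; apply: (ia n) => //; rewrite -[RHS]x0; apply: eq_bigr => j _; rewrite xE.
Qed.

(* If [Ac] missed a nonzero [Ay], the elements [y c^n] would be independent. *)
Lemma essential_principal c : finite_udim -> (forall x, x * c = 0 -> x = 0) ->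
  essential (principal c).
Proof.
move=> fA c0 y y0; apply: contrapT => hy.
have cX n x : x * c ^+ n = 0 -> x = 0.
  by elim: n x => [|n IH] x; rewrite ?mulr1 // exprS mulrA => /IH/c0.
apply: (fA (fun n => y * c ^+ n)) => [n|n r]; first by apply: contraNneq y0 => /cX ->.
elim: n r => [|n IH] r; first by move=> _ i; rewrite ltn0.
rewrite big_ord_recl expr0 mulr1 => e.
(* Every term after the first has c as a right factor. So r_0 y lies in A c and vanishes, and
   cancelling c leaves a shorter relation. *)
have e' : r 0%N * y + (\sum_(i < n) r i.+1 * (y * c ^+ i)) * c = 0.
  rewrite -[RHS]e mulr_suml; congr (_ + _); apply: eq_bigr => i _.
  by rewrite lift0 exprSr !mulrA.
have r0 : r 0%N * y = 0.
  apply/eqP; apply: contrapT => /negP ry; apply: hy; exists (r 0%N) => //.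
  by exists (- \sum_(i < n) r i.+1 * (y * c ^+ i)); rewrite mulNr; apply/eqP; rewrite -addr_eq0 e'.
move=> [_|i lin]; first by rewrite mulr1.
rewrite exprSr !mulrA -(mulrA _ y) (IH (fun i => r i.+1)) ?mul0r //.
by apply: c0; rewrite -[RHS]e' r0 add0r.
Qed.

End UniformDimension.

(* Equivalent to [A] having a semisimple left quotient ring, without mentioning
   that ring. *)
Definition goldie_order (A : nzRingType) : Prop :=
  left_ore_set (regular A) /\
  forall L, left_ideal L -> essential L -> exists2 c, L c & regular A c.

Lemma regular_multiplicative (A : nzRingType) : multiplicative_set (regular A).
Proof.
split; first by split; [exact: lreg1|exact: rreg1].
  by move=> [l0 _]; have /eqP := l0 1 0 (etrans (mul0r 1) (esym (mul0r 0))); rewrite oner_eq0.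
by move=> s t [ls rs] [lt rt]; split; [exact: lregM|exact: rregM].
Qed.

Section Goldie.
Variable A : nzRingType.
Implicit Types (L : set A) (a c x y z r : A).

(** The ideal [K] has square zero and contains x; it replaces the ideal generated by x and avoids
    its finite sums. *)
Lemma semiprime_elements : semiprime_ring A ->
  forall x, (forall r, x * r * x = 0) -> x = 0.
Proof.
move=> spA x xx.
pose J := [set y | forall r, y * r * x = 0].
pose K := [set z | J z /\ forall y, J y -> y * z = 0].
have K0 : K = [set 0].
  apply: spA => [|y z [Jy _] [_ Jz]]; last exact: Jz.
  split; [split|].
  - by split=> [r|y _]; rewrite ?mul0r ?mulr0.
  - move=> y z [Jy hy] [Jz hz]; split=> [r|t Jt]; first by rewrite !mulrDl Jy Jz addr0.
    by rewrite mulrDr hy ?hz ?addr0.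
  - move=> a z [Jz hz]; split=> [r|t Jt]; first by rewrite -!mulrA (mulrA z) Jz mulr0.
    by rewrite mulrA hz // => r; rewrite -(mulrA t) Jt.
  - move=> a z [Jz hz]; split=> [r|t Jt]; first by rewrite -(mulrA z) Jz.
    by rewrite mulrA hz ?mul0r.
suff : K x by rewrite K0.
by split=> [r //|y Jy]; rewrite -(mulr1 y) Jy.
Qed.

Lemma acc_left_annihilators_max (P : set (set A)) : acc_left_annihilators A ->
  P !=set0 -> exists2 X, P X &
    forall Y, P Y -> left_annihilator X `<=` left_annihilator Y ->
      left_annihilator Y `<=` left_annihilator X.
Proof.
move=> accA [X0 PX0]; apply: contrapT => noX.
pose T := {X | P X}.
have step (X : T) : {Y : T | left_annihilator (sval X) `<=` left_annihilator (sval Y) /\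
    ~ left_annihilator (sval Y) `<=` left_annihilator (sval X)}.
  apply: cid; case: X => X PX; apply: contrapT => hX; apply: noX; exists X => // Y PY XY.
  by apply: contrapT => nYX; apply: hX; exists (exist _ Y PY).
have [f [_ fP]] := dependent_choice step (exist _ X0 PX0).
have [N hN] := accA (fun n => sval (f n)) (fun n => (fP n).1).
by apply: (fP N).2; rewrite hN.
Qed.

Hypothesis spA : semiprime_ring A.
Hypothesis accA : acc_left_annihilators A.

Let sp := semiprime_elements spA.

(* Utumi: a nonzero element of [aA] with maximal annihilator squares to zero on
   both sides if [aA] is nil. *)
Lemma not_nilpotent_multiple a : a != 0 -> exists v, forall n, (v * a) ^+ n != 0.
Proof.
move=> a0; apply: contrapT => nv.
have nil u : exists n, (a * u) ^+ n = 0.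
  apply: contrapT => hu; apply: nv; exists u => n; apply/eqP => un.
  apply: hu; exists n.+1.
  suff -> : (a * u) ^+ n.+1 = a * (u * a) ^+ n * u by rewrite un mulr0 mul0r.
  elim: n {un} => [|n IH]; first by rewrite expr0 mulr1 expr1.
  by rewrite exprSr IH (exprSr (u * a)) !mulrA.
pose P : set (set A) := [set X | exists u, X = [set a * u] /\ a * u != 0].
have [|_ [u [-> ub0]] maxu] := @acc_left_annihilators_max P accA.
  by exists [set a]; exists 1; rewrite mulr1.
set b := a * u in ub0 maxu; case/eqP: ub0; apply: sp => r; set w := b * r.
have [k wk wk1] : exists2 k, w ^+ k != 0 & w ^+ k.+1 = 0.
  have [n] := nil (u * r); rewrite mulrA -/b -/w.
  elim: n => [/eqP|n IH wn]; first by rewrite oner_eq0.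
  by have [/IH //|wn'] := eqVneq (w ^+ n) 0; exists n.
case: k wk wk1 => [_|k wk wk1]; first by rewrite expr1 => ->; rewrite mul0r.
(* w^(k+1) is a nonzero element of a A whose left annihilator contains that of b. Maximality makes
   the two equal, and w kills w^(k+1), so w b = 0. *)
apply: (maxu [set w ^+ k.+1]) => [|z bz _ ->|_ ->|//]; last by rewrite -exprS.
  by exists (u * r * w ^+ k); rewrite !mulrA -/b -/w -exprS.
by rewrite exprS (mulrA z w) (mulrA z b r) (bz b) ?mul0r.
Qed.

(** Equivalently, A z meets the left annihilator of z in 0. *)
Definition square_cancellable z := forall r, r * z * z = 0 -> r * z = 0.

(** If the annihilators of the powers of z = v a are stationary from N on, z^(N+1) works; the
    exponent N+1 makes it a left multiple of a even for N = 0. *)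
Lemma square_cancellable_multiple a : a != 0 -> exists2 w, w * a != 0 & square_cancellable (w * a).
Proof.
move=> a0; have [v va] := not_nilpotent_multiple a0; set z := v * a in va.
have zS n : left_annihilator [set z ^+ n] `<=` left_annihilator [set z ^+ n.+1].
  by move=> r rz _ ->; rewrite exprSr mulrA rz ?mul0r.
have [N hN] := accA zS.
exists (z ^+ N * v); rewrite -mulrA -/z -exprSr // => r rz.
have : left_annihilator [set z ^+ (N.+1 + N.+1)] r.
  by move=> _ ->; rewrite exprD mulrA.
rewrite hN ?leq_addl // => [/(_ _ erefl) h|]; first by rewrite exprSr mulrA h mul0r.
by rewrite addnS addSn ltnW // ltnS leqW ?leq_addr.
Qed.

(** This is the vanishing of the left singular ideal: for a square cancellable z = w x, a nonzero
    multiple r z w killed by x would give r z z = 0, hence r z = 0. *)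
Lemma left_annihilator_not_essential x :
  (forall y, y != 0 -> exists2 r, r * y != 0 & r * y * x = 0) -> x = 0.
Proof.
move=> ex; apply/eqP; apply: contrapT => /negP x0.
have [w z0 gz] := square_cancellable_multiple x0; set z := w * x in z0 gz.
have zz : z * z != 0.
  by apply: contraNneq z0 => h; rewrite -(mul1r z) gz // mul1r.
have zw : z * w != 0 by apply: contraNneq zz => h; rewrite /z mulrA h mul0r.
have [r rzw rx] := ex _ zw; case/eqP: rzw.
by rewrite mulrA gz ?mul0r // -rx /z -!mulrA.
Qed.

(** Start from c_0 = 0 and put c_(n+1) = c_n + a_n, with a_n in L nonzero, square cancellable and
    a_n c_n = 0. If no element of L had zero left annihilator, this would never stop and the a_n
    would be independent. *)
Lemma goldie_regular : finite_udim A ->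
  forall L, left_ideal L -> essential L -> exists2 c, L c & regular A c.
Proof.
move=> fA L lL eL; have [L0 LD LM] := lL.
(* Zero left annihilator is enough: A c is then essential, and c x = c y puts it inside the left
   annihilator of x - y, so x = y. *)
suff [c Lc c0] : exists2 c, L c & forall x, x * c = 0 -> x = 0.
  exists c => //; split; last first.
    by move=> x y e; apply/subr0_eq/c0; rewrite mulrBl e subrr.
  move=> x y e; apply/subr0_eq/left_annihilator_not_essential => z z0.
  have [r rz [s rzs]] := essential_principal fA c0 z0.
  by exists r => //; rewrite rzs -mulrA mulrBr e subrr mulr0.
apply: contrapT => nc.
pose T := {c | L c /\ square_cancellable c}.
have step (c : T) : {d : T | exists a, [/\ a != 0, square_cancellable a, a * sval c = 0
    & sval d = sval c + a]}.
  apply: cid; case: c => c [Lc gc] /=.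
  have [y [Ly y0 yc]] : exists y, [/\ L y, y != 0 & y * c = 0].
    apply: contrapT => ny; apply: nc; exists c => // x xc; apply: contrapT => /eqP x0.
    by have [r rx Lrx] := eL _ x0; apply: ny; exists (r * x); rewrite -mulrA xc mulr0.
  have [w wy gwy] := square_cancellable_multiple y0; set a := w * y in wy gwy.
  have ac : a * c = 0 by rewrite -mulrA yc mulr0.
  have Lca : L (c + a) by apply: LD => //; exact: LM.
  suff gca : square_cancellable (c + a) by exists (exist _ (c + a) (conj Lca gca)), a.
  (* With this, r (c + a)^2 = 0 multiplied by c becomes r c^3 = 0, so r c = 0, and what remains is r
     a a = 0. *)
  have cac : (c + a) * c = c * c by rewrite mulrDl ac addr0.
  move=> r h; have rc : r * c = 0.
    have h3 : r * c * c * c = 0.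
      have -> : r * c * c * c = r * (c + a) * (c + a) * c.
        by rewrite -(mulrA (r * (c + a)) (c + a) c) cac (mulrA _ c c) -(mulrA r (c + a) c) cac (mulrA r c c).
      by rewrite h mul0r.
    exact: gc (gc _ h3).
  have ra : r * (c + a) = r * a by rewrite mulrDr rc add0r.
  by rewrite ra; apply: gwy; rewrite -h ra mulrDr -(mulrA r a c) ac mulr0 add0r.
have gL0 : L 0 /\ square_cancellable 0 by split=> // r _; rewrite mulr0.
have [f [_ fP]] := dependent_choice step (exist _ 0 gL0).
have [a aP] := choice fP.
pose c n := sval (f n).
have ca n : c n.+1 = c n + a n by have [] := aP n.
have ga n : square_cancellable (a n) by have [] := aP n.
have ac n : a n * c n = 0 by have [] := aP n.
(* annihilators decrease because [c_n] is square cancellable and [a_n c_n = 0] *)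
have annc n r : r * c n.+1 = 0 -> r * c n = 0 /\ r * a n = 0.
  rewrite ca mulrDr => h; suff rc : r * c n = 0 by rewrite rc add0r in h.
  have [_ gc] := svalP (f n); apply: gc.
  by rewrite -(mul0r (c n)) -h mulrDl -(mulrA _ (a n)) ac mulr0 addr0.
have annle m n r : (m <= n)%N -> r * c n = 0 -> r * c m = 0.
  move=> /subnK <-; elim: (n - m)%N => [|k IH] //.
  by rewrite addSn => /annc[/IH].
have aa i j : (i < j)%N -> a j * a i = 0.
  by move=> lij; have [] := annc i (a j) (annle i.+1 j _ lij (ac j)).
apply: (fA a) => [n|n r]; first by have [] := aP n.
(* Right multiplication of the relation by a_i removes the terms j < i by induction and the terms j
   > i by [aa]. *)
move=> r0 i; elim/ltn_ind: i => i IH lin; apply: ga.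
rewrite -[RHS](mul0r (a i)) -r0 mulr_suml (bigD1 (Ordinal lin)) //=.
rewrite big1 ?addr0 // => j ji; have [lji|lij|e] := ltngtP j i.
- by rewrite IH ?mul0r.
- by rewrite -mulrA aa ?mulr0.
- by case/eqP: ji; exact: val_inj.
Qed.

End Goldie.

(** For the Ore condition, A s is essential, hence so is the left ideal of all t with t r in A s,
    which therefore contains a regular t. *)
Theorem goldie (A : nzRingType) : semiprime_ring A -> left_goldie A -> goldie_order A.
Proof.
move=> spA [accA /finite_udimP fA]; split; last exact: goldie_regular.
split; first exact: regular_multiplicative.
move=> r s [ls rs].
have es : essential (principal s).
  by apply: essential_principal => // x xs; apply: rs; rewrite xs mul0r.
have [t [q tq] rt] := goldie_regular spA accA fA
  (left_ideal_colon r (left_ideal_principal s)) (essential_colon r (left_ideal_principal s) es).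
by exists t, q.
Qed.

(** * Orders in semisimple rings *)

(** [S] is kept general because the image of a denominator set in R / ass S is not known in advance
    to contain all regular elements. *)
Definition left_fractions (A B : nzRingType) (f : {rmorphism A -> B}) (S : set A) : Prop :=
  [/\ injective f, forall s t, S s -> S t -> S (s * t),
      forall s, S s -> exists u, u * f s = 1 /\ f s * u = 1
    & forall b, exists s r, S s /\ f s * b = f r].

Definition prime_ring (A : nzRingType) : Prop :=
  forall x y : A, (forall r, x * r * y = 0) -> x = 0 \/ y = 0.

Section LeftFractions.
Variables (A B : nzRingType) (f : {rmorphism A -> B}) (S : set A).
Implicit Types (L : set A) (a r s t x y : A) (b : B).
Hypothesis fS : left_fractions f S.

Let finj : injective f. Proof. by case: fS. Qed.
Let SM s t : S s -> S t -> S (s * t). Proof. by case: fS => _ + _ _; exact. Qed.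
Let Sunit s : S s -> exists u, u * f s = 1 /\ f s * u = 1.
Proof. by case: fS => _ _ + _; exact. Qed.
Let frac_of b : exists s r, S s /\ f s * b = f r. Proof. by case: fS. Qed.

Lemma fractions_eq0 s b : S s -> f s * b = 0 -> b = 0.
Proof.
by move=> /Sunit[u [us _]] sb; rewrite -(mul1r b) -us -mulrA sb mulr0.
Qed.

Lemma fractions_inj0 x : f x = 0 -> x = 0.
Proof. by move=> fx; apply: finj; rewrite rmorph0. Qed.

Lemma fractions_ore a s : S s -> exists t q, S t /\ t * a = q * s.
Proof.
move=> /Sunit[u [us su]]; have [t [q [St tq]]] := frac_of (f a * u).
by exists t, q; split=> //; apply: finj; rewrite !rmorphM -tq -!mulrA us mulr1.
Qed.

Lemma fractions_regular : S `<=` regular A.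
Proof.
move=> s /Sunit[u [us su]]; split=> x y e; apply: finj.
  by rewrite -(mul1r (f x)) -us -mulrA -rmorphM e rmorphM mulrA us mul1r.
by rewrite -(mulr1 (f x)) -su mulrA -rmorphM e rmorphM -mulrA su mulr1.
Qed.

Definition extension L : set B := [set b | exists s x, [/\ S s, L x & f s * b = f x]].

Lemma left_ideal_extension L : left_ideal L -> left_ideal (extension L).
Proof.
move=> [L0 LD LM]; split.
- by have [s [r [Ss _]]] := frac_of 0; exists s, 0; rewrite mulr0 rmorph0.
- move=> b b' [s [x [Ss Lx bx]]] [s' [x' [Ss' Lx' bx']]].
  have [p [q [Sp pq]]] := fractions_ore s Ss'.
  exists (p * s), (p * x + q * x'); split; [exact: SM|by apply: LD; exact: LM|].
  rewrite mulrDr rmorphD; congr (_ + _); first by rewrite !rmorphM -mulrA bx.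
  by rewrite pq !rmorphM -mulrA bx'.
- move=> b b' [s [x [Ss Lx bx]]]; have [t [r [St tr]]] := frac_of b.
  have [p [q [Sp pq]]] := fractions_ore r Ss.
  exists (p * t), (q * x); split; [exact: SM|exact: LM|].
  by rewrite !rmorphM -bx -!mulrA (mulrA (f t)) tr !mulrA -!rmorphM pq.
Qed.

Lemma common_denominator n (b : nat -> B) :
  exists2 s, S s & forall i, (i < n)%N -> exists r, f s * b i = f r.
Proof.
elim: n => [|n [s Ss hs]]; first by have [s [r [Ss _]]] := frac_of 0; exists s.
have [t [r [St tr]]] := frac_of (f s * b n).
exists (t * s) => [|i]; first exact: SM.
rewrite ltnS leq_eqVlt rmorphM => /predU1P[->|/hs[q bq]].
  by exists r; rewrite -mulrA.
by exists (t * q); rewrite -mulrA bq rmorphM.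
Qed.

(** The left ideals generated in B by the first n terms of an independent sequence stop growing;
    then some a_N is a combination of its predecessors, and a common denominator carries this
    relation back to A. *)
Lemma fractions_finite_udim : left_semisimple B -> finite_udim A.
Proof.
move=> ssB a a0 ia.
pose L n := [set x | exists r : nat -> B, x = \sum_(i < n) r i * f (a i)].
have [N LN] : exists N, forall n, L n `<=` L N.
  apply: left_semisimple_acc => // n.
    split.
    - by exists (fun=> 0); rewrite big1 // => i _; rewrite mul0r.
    - move=> _ _ [r ->] [q ->]; exists (fun i => r i + q i).
      by rewrite -big_split; apply: eq_bigr => i _; rewrite mulrDl.
    - move=> c _ [r ->]; exists (fun i => c * r i); rewrite mulr_sumr.
      by apply: eq_bigr => i _; rewrite mulrA.
  move=> _ [r ->]; exists (fun i => if (i < n)%N then r i else 0).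
  rewrite big_ord_recr /= ltnn mul0r addr0.
  by apply: eq_bigr => i _; rewrite ltn_ord.
have [|b faN] := LN N.+1 (f (a N)).
  exists (fun i => if i == N then 1 else 0).
  rewrite big_ord_recr /= eqxx mul1r big1 ?add0r // => i _.
  by rewrite ltn_eqF ?mul0r.
have [s Ss hs] := common_denominator N b.
have hr (i : nat) : exists r, (i < N)%N -> f s * b i = f r.
  have [lt|nlt] := pselect (i < N)%N; last by exists 0.
  by have [r] := hs i lt; exists r.
have [r rP] := choice hr.
have sa : s * a N = \sum_(i < N) r i * a i.
  apply: finj; rewrite rmorphM faN mulr_sumr rmorph_sum; apply: eq_bigr => i _.
  by rewrite rmorphM -rP // mulrA.
have saN : s * a N = 0.
  have := ia N.+1 (fun i => if i == N then s else - r i) _ N (ltnSn N).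
  rewrite eqxx; apply.
  rewrite big_ord_recr /= eqxx sa -big_split big1 // => i _ /=.
  by rewrite ltn_eqF ?mulNr ?addNr.
by case/eqP: (a0 N); apply/fractions_inj0/(fractions_eq0 Ss); rewrite -rmorphM saN rmorph0.
Qed.

(** If the generator e of the extension of L is not 1, then 1 - e has a nonzero numerator y. A
    nonzero multiple of y in L is fixed by right multiplication by e, but (1 - e) e = 0 makes it
    vanish. *)
Lemma essential_meets_denominators L : left_semisimple B -> left_ideal L ->
  essential L -> exists2 c, L c & S c.
Proof.
move=> ssB lL eL; have [_ _ LM] := lL.
have [e [s [x [Ss Lx ex]]] he] := ssB _ (left_ideal_extension lL).
suff e1 : e = 1 by exists s => //; rewrite (_ : s = x) //; apply: finj; rewrite -ex e1 mulr1.
apply/eqP; apply: contrapT => /negP e1.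
have [t [y [St ty]]] := frac_of (1 - e).
have y0 : y != 0.
  apply: contraNneq e1 => y0; rewrite eq_sym -subr_eq0; apply/eqP/(fractions_eq0 St).
  by rewrite ty y0 rmorph0.
have [r ry0 Lry] := eL _ y0; case/eqP: ry0.
have exL : extension L (f (r * y)) by exists s, (s * (r * y)); split; rewrite ?rmorphM //; exact: LM.
have ee : e * e = e by apply: he; exists s, x.
apply: fractions_inj0; rewrite -(he _ exL) rmorphM -ty -!mulrA mulrBl mul1r ee.
by rewrite subrr !mulr0.
Qed.

(** The Ore condition concerns all regular c, not only those known to be units in B; essentiality of
    A c supplies it, with t found in [S]. *)
Lemma fractions_goldie_order : left_semisimple B -> goldie_order A.
Proof.
move=> ssB; split; last first.
  move=> L lL /(essential_meets_denominators ssB lL)[c Lc /fractions_regular].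
  by exists c.
split; first exact: regular_multiplicative.
move=> r c [lc rc].
have ec : essential (principal c).
  apply: essential_principal; first exact: fractions_finite_udim.
  by move=> x xs; apply: rc; rewrite xs mul0r.
have [t [q tq] St] := essential_meets_denominators ssB
  (left_ideal_colon r (left_ideal_principal c)) (essential_colon r (left_ideal_principal c) ec).
by exists t, q; split=> //; exact: fractions_regular.
Qed.

(** A left annihilator in A is the contraction of the left annihilator of the same set in B, and
    clearing denominators shows that the latter ascend too. *)
Lemma fractions_acc : left_semisimple B -> acc_left_annihilators A.
Proof.
move=> ssB X sX.
pose L n := left_annihilator (f @` X n).
have [N hN] : exists N, forall n, L n `<=` L N.
  apply: left_semisimple_acc => // n.
    split; first by move=> x _; rewrite mul0r.
      by move=> x y hx hy z Xz; rewrite mulrDl hx ?hy ?addr0.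
    by move=> a x hx z Xz; rewrite -mulrA hx ?mulr0.
  move=> b hb _ [x Xx <-]; have [s [r [Ss sr]]] := frac_of b.
  apply: (fractions_eq0 Ss); rewrite mulrA sr -rmorphM (sX n r) ?rmorph0 // => z Xz.
  by apply: fractions_inj0; rewrite rmorphM -sr -mulrA hb ?mulr0 //; exists z.
exists N => n leNn; apply/seteqP; split=> r hr.
  move=> x Xx; apply: fractions_inj0; rewrite rmorphM.
  apply: (hN n (f r)); last by exists x.
  by move=> _ [z Xz <-]; rewrite -rmorphM hr ?rmorph0.
move: hr; rewrite -(subnK leNn); elim: (n - N)%N => [|k IH] // /IH.
by rewrite addSn; exact: sX.
Qed.

(** The right annihilator [L] of [I] is essential because it contains every i y with i in [I]; a
    regular element in it forces I = 0. *)
Lemma fractions_semiprime : left_semisimple B -> semiprime_ring A.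
Proof.
move=> ssB I [[I0 ID IM] IMr] II.
pose L := [set x | forall y, I y -> y * x = 0].
have lL : left_ideal L.
  split; first by move=> y _; rewrite mulr0.
    by move=> x z hx hz y Iy; rewrite mulrDr hx ?hz ?addr0.
  by move=> a x hx y Iy; rewrite mulrA hx //; exact: IMr.
have eL : essential L.
  move=> y y0; have [[i [Ii iy]]|ni] := pselect (exists i, I i /\ i * y != 0).
    exists i => // j Ij.
    by rewrite mulrA (II j i Ij Ii) mul0r.
  exists 1; rewrite mul1r // => i Ii; apply/eqP; apply: contrapT => /negP iy.
  by apply: ni; exists i.
have [c Lc Sc] := essential_meets_denominators ssB lL eL.
apply/seteqP; split=> [x Ix|_ ->//]; have [_ rc] := fractions_regular Sc.
by apply: rc; rewrite mul0r Lc.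
Qed.

Lemma fractions_goldie : left_semisimple B -> semiprime_ring A /\ left_goldie A.
Proof.
move=> ssB; split; first exact: fractions_semiprime.
split; first exact: fractions_acc.
exact/finite_udimP/fractions_finite_udim.
Qed.

(** The ideal of all i with i A y = 0 has to extend to a two-sided ideal of B. Stability under right
    multiplication by inverses is not formal: it comes from the ascending chain condition in B. *)
Lemma fractions_prime : left_semisimple B -> simple_ring B -> prime_ring A.
Proof.
move=> ssB simB x y xy; apply: contrapT => /not_orP[/eqP x0 /eqP y0].
pose I := [set i | forall r, i * r * y = 0].
have lI : left_ideal I.
  split; first by move=> r; rewrite !mul0r.
    by move=> i j Ii Ij r; rewrite !mulrDl Ii Ij addr0.
  by move=> a i Ii r; rewrite -!mulrA (mulrA i) Ii mulr0.
have lX := left_ideal_extension lI.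
have XS r b : extension I b -> extension I (b * f r).
  move=> [s [i [Ss Ii bi]]]; exists s, (i * r); split=> //.
    by move=> q; rewrite -(mulrA i) Ii.
  by rewrite mulrA bi rmorphM.
(* [X f(s)^-n] is an ascending chain of left ideals *)
have XV s b : S s -> extension I (b * f s) -> extension I b.
  move=> Ss Xbs; have [u [us su]] := Sunit Ss.
  pose L n := [set c | extension I (c * f s ^+ n)].
  have [N hN] : exists N, forall n, L n `<=` L N.
    apply: left_semisimple_acc => // n; last first.
      by move=> c; rewrite /L /= exprSr mulrA; exact: XS.
    case: lX => X0 XD XM; split; rewrite /L /= ?mul0r //.
      by move=> c d /= Xc Xd; rewrite mulrDl; exact: XD.
    by move=> c d /= Xd; rewrite -mulrA; exact: XM.
  have uN k : u ^+ k * f s ^+ k = 1.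
    elim: k => [|k IH]; first by rewrite mulr1.
    by rewrite exprSr (exprS (f s)) mulrA -(mulrA _ u) us mulr1.
  (* This element is in [L N.+1] because b f(s) is in the extension, hence in [L N], which says that
     b is in the extension. *)
  have : L N (b * u ^+ N).
    apply: (hN N.+1); rewrite /L /= exprSr mulrA -(mulrA b) uN mulr1.
    exact: Xbs.
  by rewrite /L /= -mulrA uN mulr1.
have tX : two_sided_ideal (extension I).
  split=> // b c Xc; have [s [r [Ss sr]]] := frac_of b; have [u [us su]] := Sunit Ss.
  rewrite -(mul1r b) -us -(mulrA u) sr mulrA; apply: XS; apply: (XV s) => //.
  by rewrite -mulrA us mulr1.
have [X0|XT] := simB _ tX.
  case/eqP: x0; apply: fractions_inj0; have [s [r [Ss sr]]] := frac_of 1.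
  suff : extension I (f x) by rewrite X0.
  exists s, (s * x); split; rewrite ?rmorphM //.
  by move=> q; rewrite -!mulrA (mulrA x) xy mulr0.
have : extension I 1 by rewrite XT.
move=> [s [i [Ss Ii]]]; rewrite mulr1 => /finj si.
have [ls _] := fractions_regular Ss; case/eqP: y0; apply: ls.
by rewrite mulr0 si -(mulr1 i) Ii.
Qed.

(** An essential left ideal of B contracts to an essential left ideal of A, which contains a regular
    element, a unit of B. *)
Lemma goldie_order_left_semisimple : S = regular A -> goldie_order A -> left_semisimple B.
Proof.
move=> SE [_ gA]; apply: left_semisimple_essential => L lL eL.
have [L0 LD LM] := lL.
have [|y y0|c Lc] := gA [set a | L (f a)].
- split; first by rewrite /= rmorph0.
    by move=> a b /= La Lb; rewrite rmorphD; exact: LD.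
  by move=> a b /= Lb; rewrite rmorphM; exact: LM.
- have fy0 : f y != 0 by apply: contraNneq y0 => /fractions_inj0 ->.
  have [b by0 Lby] := eL _ fy0; have [s [r [Ss sr]]] := frac_of b.
  exists r; last by rewrite /= rmorphM -sr -mulrA; exact: LM.
  apply: contraNneq by0 => ry; apply/eqP/(fractions_eq0 Ss).
  by rewrite mulrA sr -rmorphM ry rmorph0.
- by rewrite -SE => /Sunit[u [us _]]; rewrite -us; exact: LM.
Qed.

(** Primeness makes the contraction of a nonzero ideal essential, so it contains a regular element,
    a unit of B. *)
Lemma goldie_order_simple : S = regular A -> goldie_order A -> prime_ring A ->
  simple_ring B.
Proof.
move=> SE [_ gA] pA I tI; have [lI IM] := tI; have [I0 ID IMl] := lI.
have [->|nI] := pselect (I = [set 0]); [by left|right].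
have {nI} [b Ib b0] : exists2 b, I b & b != 0.
  by apply/(left_ideal_neq0P lI)/eqP.
have [s [x [Ss sx]]] := frac_of b.
have Ifx : I (f x) by rewrite -sx; exact: IMl.
have x0 : x != 0.
  by apply: contraNneq b0 => x0; apply/eqP/(fractions_eq0 Ss); rewrite sx x0 rmorph0.
have [|y y0|c Ic] := gA [set a | I (f a)].
- split; first by rewrite /= rmorph0.
    by move=> a c /= Ia Ic; rewrite rmorphD; exact: ID.
  by move=> a c /= Ic; rewrite rmorphM; exact: IMl.
- have [r xry] : exists r, x * r * y != 0.
    apply: contrapT => nr; have [|/eqP|/eqP] := pA x y; rewrite ?(negPf x0) ?(negPf y0) //.
    by move=> r; apply/eqP; apply: contrapT => /negP h; apply: nr; exists r.
  exists (x * r) => //.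
  by rewrite /= -mulrA rmorphM; exact: IM.
- rewrite -SE => /Sunit[u [us _]]; apply/seteqP; split=> // d _.
  by rewrite -(mulr1 d) -us mulrA; exact: IMl.
Qed.

End LeftFractions.

(** * Goldie's conditions modulo an ideal *)

Section RelativeNotions.
Variable R : nzRingType.
Implicit Types (p l L : set R) (c r s t x y : R).

Definition regular_modulo p : set R :=
  [set c | forall x, (p (c * x) -> p x) /\ (p (x * c) -> p x)].

Definition prime_modulo p : Prop :=
  ~ p 1 /\ forall x y, (forall r, p (x * r * y)) -> p x \/ p y.

(* [goldie_order (R/p)] pulled back to [R]. *)
Definition goldie_modulo p : Prop :=
  (forall r c, regular_modulo p c ->
     exists t q, regular_modulo p t /\ p (t * r - q * c)) /\
  forall L, left_ideal L -> p `<=` L ->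
    (forall y, ~ p y -> exists2 r, ~ p (r * y) & L (r * y)) ->
    exists2 c, L c & regular_modulo p c.

Lemma two_sided_idealB p x y : two_sided_ideal p -> p x -> p y -> p (x - y).
Proof. by move=> [lp _]; exact: left_idealB. Qed.

Lemma two_sided_ideal_shift p x y : two_sided_ideal p -> p (x - y) -> p x -> p y.
Proof. by move=> tp pxy px; rewrite -(subKr x y); exact: two_sided_idealB. Qed.

Lemma two_sided_ideal_ass (S : set R) s x : left_den_set S -> S s ->
  ass S (s * x) \/ ass S (x * s) -> ass S x.
Proof.
move=> dS Ss [[t St]|[t St]]; have [[[_ _ SM] _] canc] := dS.
  by rewrite mulrA => tsx; exists (t * s) => //; exact: SM.
rewrite mulrA => /(canc _ _ Ss)[u Su]; rewrite mulrA => utx.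
by exists (u * t) => //; exact: SM.
Qed.

Lemma regular_moduloM p c d : regular_modulo p c -> regular_modulo p d ->
  regular_modulo p (c * d).
Proof.
move=> rc rd x; split; first by rewrite -mulrA => /(rc _).1/(rd _).1.
by rewrite mulrA => /(rd _).2/(rc _).2.
Qed.

Lemma regular_modulo1 p : regular_modulo p 1.
Proof. by move=> x; rewrite mul1r mulr1. Qed.

Lemma regular_modulo_shift p c d : two_sided_ideal p -> p (c - d) ->
  regular_modulo p c -> regular_modulo p d.
Proof.
move=> tp pcd rc x; have [[_ _ pM] pMr] := tp.
have pdc : p (d - c) by rewrite -opprB; apply: left_idealN => //; exact: tp.1.
split=> h; [apply: (rc x).1|apply: (rc x).2].
  by apply: (two_sided_ideal_shift tp _ h); rewrite -mulrBl; exact: pMr.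
by apply: (two_sided_ideal_shift tp _ h); rewrite -mulrBr; exact: pM.
Qed.

(** An Ore relation modulo p becomes an equality after left multiplication by an element that kills
    the error. *)
Lemma regular_modulo_ass p : two_sided_ideal p -> ~ p 1 ->
  (forall r c, regular_modulo p c ->
     exists t q, regular_modulo p t /\ p (t * r - q * c)) ->
  (forall x, p x -> exists2 s, regular_modulo p s & s * x = 0) ->
  left_den_set (regular_modulo p) /\ ass (regular_modulo p) = p.
Proof.
move=> tp p1 ore kp; have [[p0 _ _] _] := tp.
have assp : ass (regular_modulo p) = p.
  apply/seteqP; split=> [x [s rs sx]|x /kp//].
  by apply: (rs x).1; rewrite sx.
split=> //; split; last first.
  by move=> r s rs rs0; rewrite assp; apply: (rs r).2; rewrite rs0.
split; first split.
- exact: regular_modulo1.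
- by move=> /(_ 1)[h _]; apply: p1; apply: h; rewrite mul0r.
- by move=> s t; exact: regular_moduloM.
move=> r s rs; have [t [q [rt ptq]]] := ore r s rs.
have [u ru uE] := kp _ ptq; exists (u * t), (u * q).
split; first exact: regular_moduloM.
by apply/eqP; rewrite -subr_eq0 -!mulrA -mulrBr uE.
Qed.

(** In the forward direction [J] and [K] stand in for the ideals generated by x and y, without their
    finite sums. *)
Lemma prime_idealP p : prime_ideal p <-> two_sided_ideal p /\ prime_modulo p.
Proof.
split=> [[tp p1 pp]|[tp [p1 pp]]].
  split=> //; split=> // x y xy; have [[p0 pD pM] pMr] := tp.
  pose J := [set a | forall r, p (a * r * y)].
  pose K := [set b | forall a, J a -> p (a * b)].
  have tJ : two_sided_ideal J.
    split; [split|].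
    - by move=> r; rewrite !mul0r.
    - by move=> a b Ja Jb r; rewrite !mulrDl; exact: pD.
    - by move=> a b Jb r; rewrite -!mulrA; apply: pM; rewrite mulrA.
    - by move=> a b Jb r; rewrite -(mulrA b).
  have tK : two_sided_ideal K.
    split; [split|].
    - by move=> a _; rewrite mulr0.
    - by move=> a b Ka Kb c Jc; rewrite mulrDr; apply: pD; auto.
    - by move=> a b Kb c Jc; rewrite mulrA; apply: Kb; apply: tJ.2.
    - by move=> a b Kb c Jc; rewrite mulrA; apply: pMr; exact: Kb.
  have [a b Ja Kb||] := pp J K tJ tK; first exact: Kb.
    by move=> Jp; left; apply: Jp.
  by move=> Kp; right; apply: Kp => a Ja; rewrite -(mulr1 a); exact: Ja.
split=> // J K [[_ _ _] JM] _ JK.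
apply: contrapT => /not_orP[/existsNP[x /not_implyP[Jx px]] /existsNP[y /not_implyP[Ky py]]].
by case: (pp x y) => // r; apply: JK => //; exact: JM.
Qed.

End RelativeNotions.

Section Transport.
Variables (R A : nzRingType) (g : {rmorphism R -> A}).
Hypothesis gsurj : forall a, exists r, g r = a.
Implicit Types (q : set A) (L : set R).

Lemma left_ideal_preimage (K : set A) : left_ideal K -> left_ideal (g @^-1` K).
Proof.
move=> [K0 KD KM]; split; rewrite /preimage /= ?rmorph0 //.
  by move=> x y Kx Ky; rewrite rmorphD; exact: KD.
by move=> a x Kx; rewrite rmorphM; exact: KM.
Qed.

Lemma two_sided_ideal_preimage q : two_sided_ideal q -> two_sided_ideal (g @^-1` q).
Proof.
move=> [lq qM]; split; first exact: left_ideal_preimage.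
by move=> a x qx; rewrite /preimage /= rmorphM; exact: qM.
Qed.

Lemma left_ideal_image L : left_ideal L -> left_ideal (g @` L).
Proof.
move=> [L0 LD LM]; split.
- by exists 0 => //; rewrite rmorph0.
- by move=> _ _ [x Lx <-] [y Ly <-]; exists (x + y); rewrite ?rmorphD //; exact: LD.
- move=> a _ [x Lx <-]; have [r <-] := gsurj a.
  by exists (r * x); rewrite ?rmorphM //; exact: LM.
Qed.

Lemma regular_modulo_preimage q :
  regular_modulo (g @^-1` q) = g @^-1` (regular_modulo q).
Proof.
apply/seteqP; split=> c rc x; last by rewrite /preimage /= !rmorphM; exact: rc.
by have [r <-] := gsurj x; rewrite -!rmorphM; exact: rc.
Qed.

Lemma prime_modulo_preimage q : prime_modulo q -> prime_modulo (g @^-1` q).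
Proof.
move=> [q1 qp]; split; first by rewrite /preimage /= rmorph1.
move=> x y xy; apply: qp => a; have [r <-] := gsurj a.
by rewrite -!rmorphM; exact: xy.
Qed.

Lemma goldie_modulo_preimage q : goldie_modulo (g @^-1` q) <-> goldie_modulo q.
Proof.
rewrite /goldie_modulo regular_modulo_preimage.
split=> -[ore ess]; split.
- move=> a b; have [r <-] := gsurj a; have [c <-] := gsurj b => rc.
  have [t [u [rt tu]]] := ore r c rc; exists (g t), (g u); split=> //.
  by move: tu; rewrite /preimage /= rmorphB !rmorphM.
- move=> K lK qK eK.
  have [||y qy|c Kc rc] := ess (g @^-1` K); last by exists (g c).
  + exact: left_ideal_preimage.
  + by move=> x; exact: qK.
  + have [a] := eK _ qy; have [r <-] := gsurj a; rewrite -rmorphM => ? ?.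
    by exists r.
- move=> r c rc; have [a [b [ra ab]]] := ore (g r) (g c) rc.
  have [t tE] := gsurj a; have [u uE] := gsurj b; exists t, u; split.
    by rewrite /preimage /= tE.
  by rewrite /preimage /= rmorphB !rmorphM tE uE.
- move=> L lL qL eL.
  have [||a qa|_ [c Lc <-] rc] := ess (g @` L); last by exists c.
  + exact: left_ideal_image.
  + by move=> a qa; have [r rE] := gsurj a; exists r => //; apply: qL; rewrite /preimage /= rE.
  + have [y yE] := gsurj a; have [|r ry Lry] := eL y; first by rewrite /preimage /= yE.
    exists (g r); first by move: ry; rewrite /preimage /= rmorphM yE.
    by exists (r * y) => //; rewrite rmorphM yE.
Qed.

End Transport.

Lemma regular_modulo0 (A : nzRingType) : regular_modulo [set 0] = regular A.
Proof.
apply/seteqP; split=> c.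
  move=> rc; split=> x y e; apply/subr0_eq; have [l r] := rc (x - y).
    by apply: l; rewrite /= mulrBr e subrr.
  by apply: r; rewrite /= mulrBl e subrr.
by move=> [lc rc] x; split=> /= h; [apply: lc|apply: rc]; rewrite h ?mulr0 ?mul0r.
Qed.

Lemma goldie_modulo0 (A : nzRingType) : goldie_modulo [set 0 : A] <-> goldie_order A.
Proof.
rewrite /goldie_modulo regular_modulo0; split=> -[ore ess]; split.
- split; first exact: regular_multiplicative.
  by move=> r c rc; have [t [q [rt /subr0_eq tq]]] := ore r c rc; exists t, q.
- move=> L lL eL; apply: ess => // [x ->|y /eqP y0]; first by case: lL.
  by have [r /eqP ry Lry] := eL y y0; exists r.
- move=> r c rc; have [t [q [rt tq]]] := ore.2 r c rc; exists t, q; split=> //.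
  by rewrite /= tq subrr.
- move=> L lL _ eL; apply: ess => // y /eqP y0.
  by have [r /eqP ry Lry] := eL y y0; exists r.
Qed.

Lemma prime_ring_semiprime (A : nzRingType) : prime_ring A -> semiprime_ring A.
Proof.
move=> pA I [[I0 ID IM] IMr] II; apply/seteqP; split=> [x Ix|_ ->//].
by have [r|//|//] := pA x x; apply: II => //; exact: IMr.
Qed.

Section QuotientRings.
Variables (R : nzRingType) (p : properIdeal R).

Lemma quot_pi_surj (a : quot_ring p) : exists r, quot_pi p r = a.
Proof. by exists (repr a); exact: quot_pi_repr. Qed.

Lemma quot_pi_range : range (quot_pi p) = setT.
Proof. by apply/seteqP; split=> // a _; have [r <-] := quot_pi_surj a; exists r. Qed.

Lemma quot_pi_eq0 x : quot_pi p x = 0 <-> (p : set R) x.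
Proof. by rewrite -(rmorph0 (quot_pi p)) quot_piP subr0. Qed.

Lemma quot_pi_kernel : quot_pi p @^-1` [set 0] = p.
Proof. by apply/seteqP; split=> x /quot_pi_eq0. Qed.

Lemma regular_modE : regular_mod p = regular_modulo p.
Proof.
by rewrite /regular_mod -regular_modulo0 -(regular_modulo_preimage quot_pi_surj) quot_pi_kernel.
Qed.

Lemma goldie_order_quot : goldie_order (quot_ring p) <-> goldie_modulo p.
Proof.
by rewrite -quot_pi_kernel -goldie_modulo0; split=> /(goldie_modulo_preimage quot_pi_surj).
Qed.

Lemma prime_ring_quot : prime_ring (quot_ring p) <-> prime_modulo p.
Proof.
split=> [pQ|[_ pp]].
  split=> [|x y xy]; first exact: properIdeal_proper.
  have [a||] := pQ (quot_pi p x) (quot_pi p y).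
  - have [r <-] := quot_pi_surj a.
    by have /quot_pi_eq0 := xy r; rewrite !rmorphM.
  - by move/quot_pi_eq0; left.
  - by move/quot_pi_eq0; right.
move=> a b; have [x <-] := quot_pi_surj a; have [y <-] := quot_pi_surj b => xy.
have [r||] := pp x y; first by apply/quot_pi_eq0; rewrite !rmorphM.
- by move/quot_pi_eq0; left.
- by move/quot_pi_eq0; right.
Qed.

End QuotientRings.

Lemma properIdeal_inj (R : nzRingType) (p q : properIdeal R) : (p : set R) = q -> p = q.
Proof.
case: p q => p tp p1 [q tq q1] /= pq; rewrite -pq in tq q1 *.
by rewrite (Prop_irrelevance tp tq) (Prop_irrelevance p1 q1).
Qed.

Lemma finite_set_enum (T : pointedType) (F : set T) : finite_set F ->
  exists n (f : 'I_n -> T), [/\ forall i, F (f i), injective f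
    & forall x, F x -> exists i, f i = x].
Proof.
move=> [n Fn].
have [f [fF finj fsurj]] : exists f : nat -> T, set_bij `I_n F f.
  by apply/card_set_bijP; rewrite card_eq_sym.
exists n, (fun i => f i); split=> [i|i j fij|x /fsurj[k kn <-]].
- by apply: fF; exact: ltn_ord.
- by apply: val_inj; apply: finj; [by rewrite inE /=|by rewrite inE /=|].
- by exists (@Ordinal n k kn).
Qed.

(** * Finite intersections of primes with Goldie quotients *)

(** The third clause gives incomparability and injectivity of the indexing at once. *)
Definition goldie_decomposition (R : nzRingType) (l : set R) (I : finType)
    (p : I -> set R) : Prop :=
  [/\ forall i, two_sided_ideal (p i), forall i, prime_modulo (p i),
      forall i j, p i `<=` p j -> i = j, forall i, goldie_modulo (p i)
    & forall x, l x <-> forall i, p i x].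

Lemma prime_avoidance (R : nzRingType) (I : eqType) (q : set R) (p : I -> set R) (s : seq I) :
  (forall i, two_sided_ideal (p i)) -> prime_modulo q ->
  (forall i, i \in s -> ~ p i `<=` q) ->
  exists2 y, ~ q y & forall i, i \in s -> p i y.
Proof.
move=> tp [q1 qq]; elim: s => [|i s IH] hs; first by exists 1.
have [j js|y qy hy] := IH; first by apply: hs; rewrite inE js orbT.
have [x /not_implyP[pix qx]] : exists x, ~ (p i x -> q x).
  by apply/existsNP/hs; rewrite inE eqxx.
have [r qr] : exists r, ~ q (x * r * y) by apply/existsNP => /qq[].
exists (x * r * y) => // j; rewrite inE => /predU1P[->|/hy py].
  by rewrite -mulrA; exact: (tp i).2.
by case: (tp j) => -[_ _ pM] _; exact: pM.
Qed.

Section Decomposition.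
Variables (R : nzRingType) (l : set R) (I : finType) (p : I -> set R).
Hypothesis dec : goldie_decomposition l p.
Implicit Types (c d r s t x y : R) (S L : set R).

Let tp i : two_sided_ideal (p i). Proof. by case: dec. Qed.
Let pp i : prime_modulo (p i). Proof. by case: dec. Qed.
Let incomparable i j : p i `<=` p j -> i = j. Proof. by case: dec => _ _ + _ _; exact. Qed.
Let gp i : goldie_modulo (p i). Proof. by case: dec. Qed.
Let lE x : l x <-> forall i, p i x. Proof. by case: dec. Qed.
Let pM i a x : p i x -> p i (a * x). Proof. by case: (tp i) => -[_ _ + _]; exact. Qed.
Let pMr i a x : p i x -> p i (x * a). Proof. by case: (tp i) => _; exact. Qed.
Let p0 i : p i 0. Proof. by case: (tp i) => -[]. Qed.

Let prod_notin i x y : ~ p i x -> ~ p i y -> exists r, ~ p i (x * r * y).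
Proof.
by move=> px py; apply/existsNP => h; have [_ /(_ x y h)[]] := pp i.
Qed.

Let sum_modulo (F : I -> R) i : (forall j, j != i -> p i (F j)) -> p i (F i - \sum_j F j).
Proof.
move=> hF; rewrite (bigD1 i) //= opprD addNKr; have [[_ pD _] _] := tp i.
apply: left_idealN; first exact: (tp i).1.
by elim/big_ind: _ => // x y; exact: pD.
Qed.

(** The intersection of the other primes is nonzero modulo [p i], hence essential there because
    [p i] is prime, so it contains an element regular modulo [p i]. *)
Lemma decomposition_separator i : exists2 d, regular_modulo (p i) d &
  forall j, j != i -> p j d.
Proof.
have [j jE|b pb hb] := @prime_avoidance R I (p i) p [seq j <- enum I | j != i] tp (pp i).
  by move=> /incomparable ji; move: jE; rewrite ji mem_filter eqxx.
have {}hb j : j != i -> p j b by move=> ji; apply: hb; rewrite mem_filter ji mem_enum.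
pose L := [set z | exists w, (forall j, j != i -> p j w) /\ p i (z - w)].
have [[_ pD _] _] := tp i.
have [||y py|c [d [hd pcd]] rc] := (gp i).2 L; last first.
- by exists d => //; exact: regular_modulo_shift rc.
- have [r pbr] := prod_notin pb py; exists (b * r) => //.
  exists (b * r * y); rewrite subrr; split=> // j ji; rewrite -mulrA.
  exact/pMr/hb.
- by move=> x px; exists 0; rewrite subr0; split=> // j _.
- split.
  + by exists 0; rewrite subrr; split=> // j _.
  + move=> x y [w [hw xw]] [w' [hw' yw]]; exists (w + w'); split.
      by move=> j ji; case: (tp j) => -[_ D _] _; apply: D; auto.
    by rewrite opprD addrACA; exact: pD.
  + move=> a x [w [hw xw]]; exists (a * w); split; first by move=> j /hw; exact: pM.
    by rewrite -mulrBr; exact: pM.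
Qed.

Let two_sided_l : two_sided_ideal l.
Proof.
split; [split|].
- by apply/lE.
- move=> x y /lE lx /lE ly; apply/lE => i; case: (tp i) => -[_ D _] _; exact: D.
- by move=> a x /lE lx; apply/lE => i; exact: pM.
- by move=> a x /lE lx; apply/lE => i; exact: pMr.
Qed.

Let l_of_factor i x : p i x -> (forall j, j != i -> p j x) -> l x.
Proof. by move=> px h; apply/lE => j; have [->|/h] := eqVneq j i. Qed.

Let regular_decomposition c : (forall i, regular_modulo (p i) c) -> regular_modulo l c.
Proof.
by move=> rc x; split=> /lE h; apply/lE => i; [apply: (rc i x).1|apply: (rc i x).2]; exact: h.
Qed.

Lemma decomposition_goldie_modulo : goldie_modulo l.
Proof.
have [d dP] := choice (fun i => let: ex_intro2 d h1 h2 := decomposition_separator i in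
   ex_intro (fun d => regular_modulo (p i) d /\ forall j, j != i -> p j d) d (conj h1 h2)).
have rd i : regular_modulo (p i) (d i) by have [] := dP i.
have pd i j : j != i -> p j (d i) by have [_] := dP i; exact.
split.
- move=> r c rc.
  (* If c x is in p_i, then c x d_i is in l, so x d_i is in l and d_i cancels modulo p_i; the other
     side is symmetric. *)
  have rci i : regular_modulo (p i) c.
    move=> x; split=> h.
      apply: (rd i x).2; apply: (proj1 (lE _)); apply: (rc _).1; rewrite mulrA.
      by apply: (@l_of_factor i) => [|j ji]; [exact: pMr|apply: pM; exact: pd].
    apply: (rd i x).1; apply: (proj1 (lE _)); apply: (rc _).2; rewrite -mulrA.
    by apply: (@l_of_factor i) => [|j ji]; [exact: pM|apply: pMr; exact: pd].
  have ore i : exists tq, regular_modulo (p i) tq.1 /\ p i (tq.1 * r - tq.2 * c).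
    by have [t [q tq]] := (gp i).1 r c (rci i); exists (t, q).
  have [tq tqP] := choice ore.
  (* Modulo p_i the first sum is congruent to its i-th term, and each d_i (t_i r - q_i c) lies in
     l. *)
  exists (\sum_i d i * (tq i).1), (\sum_i d i * (tq i).2); split.
    apply: regular_decomposition => i.
    apply: (@regular_modulo_shift _ _ (d i * (tq i).1)) => //.
      by apply: (@sum_modulo (fun i => d i * (tq i).1)) => j ji; apply: pMr; apply: pd; rewrite eq_sym.
    by apply: regular_moduloM; [exact: rd|have [] := tqP i].
  rewrite !mulr_suml -sumrB; have [l0 lD lM] := two_sided_l.1.
  elim/big_ind: _ => // i _; rewrite -!mulrA -mulrBr.
  apply: (@l_of_factor i) => [|j ji]; first by apply: pM; have [] := tqP i.
  by apply: pMr; exact: pd.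
- move=> L lL subL eL; have [L0 LD LM] := lL.
  have cP i : exists w, [/\ L w, forall j, j != i -> p j w & regular_modulo (p i) w].
    (* [Li] is p_i plus the part of L inside all other primes. Replacing y by d_i y before using
       essentiality modulo l keeps the multiple in those primes. *)
    pose Li := [set z | exists w, [/\ L w, forall j, j != i -> p j w & p i (z - w)]].
    have [[_ pD _] _] := tp i.
    have [||y py|c [w [Lw hw pcw]] rc] := (gp i).2 Li; last first.
    + by exists w; split=> //; exact: regular_modulo_shift rc.
    + have ldy : ~ l (d i * y) by move=> /lE h; apply: py; apply: (rd i y).1; exact: h.
      have [r lrdy Lrdy] := eL _ ldy; exists (r * d i); rewrite -mulrA.
        move=> h; apply: lrdy; apply: (@l_of_factor i) => // j ji.
        by apply: pM; apply: pMr; exact: pd.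
      exists (r * (d i * y)); rewrite subrr; split=> // j ji.
      by apply: pM; apply: pMr; exact: pd.
    + by move=> x px; exists 0; rewrite subr0; split=> // j _.
    + split.
      * by exists 0; rewrite subrr; split=> // j _.
      * move=> x y [w [Lw hw xw]] [w' [Lw' hw' yw]]; exists (w + w'); split.
        - exact: LD.
        - by move=> j ji; case: (tp j) => -[_ D _] _; apply: D; auto.
        - by rewrite opprD addrACA; exact: pD.
      * move=> a x [w [Lw hw xw]]; exists (a * w); split; first exact: LM.
          by move=> j /hw; exact: pM.
        by rewrite -mulrBr; exact: pM.
  have [w wP] := choice cP.
  exists (\sum_i w i); first by elim/big_ind: _ => // i _; have [] := wP i.
  apply: regular_decomposition => i; have [_ _ rw] := wP i.
  apply: regular_modulo_shift rw => //; apply: sum_modulo => j ji.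
  by have [_ h _] := wP j; apply: h; rewrite eq_sym.
Qed.

Lemma denominator_set_decomposition S : left_den_set S -> l `<=` ass S ->
  exists i, [/\ S `<=` regular_modulo (p i), left_den_set (regular_modulo (p i))
              & ass (regular_modulo (p i)) = p i].
Proof.
move=> dS lS; have [_ gl] := decomposition_goldie_modulo.
have tS := ass_two_sided_ideal dS; have [_ SMr] := tS.
have [i aSp] : exists i, ass S `<=` p i.
  apply: contrapT => h.
  (* If s c = 0 with s in S and c regular modulo l, then s lies in l, hence in [ass S], and S would
     contain 0. *)
  have [y ly|c [s Ss sc] rc] := gl (ass S) tS.1 lS; last first.
  - have /lS[t St ts] : l s by apply: (rc s).2; rewrite sc; case: two_sided_l => -[].
    by have [[[_ nS0 multS] _] _] := dS; apply: nS0; rewrite -ts; exact: multS.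
  - have [i py] : exists i, ~ p i y by apply/existsNP => /lE.
    have /existsNP[x /not_implyP[ax px]] : ~ (ass S `<=` p i) by move=> ?; apply: h; exists i.
    have [r pxry] := prod_notin px py; exists (x * r).
      by move=> /lE.
    by rewrite -mulrA; exact: SMr.
have [d rd pd] := decomposition_separator i.
(* If s x is in p_i, then s x d is in l, so in [ass S]; there s cancels, and then d cancels modulo
   p_i. *)
have Sr : S `<=` regular_modulo (p i).
  move=> s Ss x; split=> h.
    apply: (rd x).2; apply: aSp; apply: (two_sided_ideal_ass dS Ss); left; apply: lS.
    by rewrite mulrA; apply: (@l_of_factor i) => [|j ji]; [exact: pMr|apply: pM; exact: pd].
  apply: (rd x).1; apply: aSp; apply: (two_sided_ideal_ass dS Ss); right; apply: lS.
  by rewrite -mulrA; apply: (@l_of_factor i) => [|j ji]; [exact: pM|apply: pMr; exact: pd].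
have [dSp assSp] : left_den_set (regular_modulo (p i)) /\ ass (regular_modulo (p i)) = p i.
  apply: regular_modulo_ass => //; [by case: (pp i)|exact: (gp i).1|] => x px.
  (* d moves x into l, an element s of S kills the result, and s d is again regular modulo p_i. *)
  have /lS[s Ss sdx] : l (d * x).
    by apply: (@l_of_factor i) => [|j ji]; [exact: pM|apply: pMr; exact: pd].
  exists (s * d); last by rewrite -mulrA.
  by apply: regular_moduloM => //; exact: Sr.
by exists i.
Qed.

Lemma regular_modulo_inj i j : ass (regular_modulo (p i)) = p i ->
  ass (regular_modulo (p j)) = p j ->
  regular_modulo (p i) `<=` regular_modulo (p j) -> i = j.
Proof.
move=> ai aj sij; apply: incomparable; rewrite -ai -aj => x [s rs sx].
by exists s => //; exact: sij.
Qed.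

Lemma max_den_decomposition S : max_den R S -> l `<=` ass S ->
  exists2 i, S = regular_modulo (p i) & ass S = p i.
Proof.
move=> [dS maxS] lS; have [i [Si di ai]] := denominator_set_decomposition dS lS.
by exists i; rewrite -(maxS _ di Si).
Qed.

(** Meant for l = 0, that is for the quotient by the radical, where the first hypothesis is
    immediate. *)
Lemma regular_modulo_max_den :
  (forall S, left_den_set S -> l `<=` ass S) ->
  (forall i x, p i x -> exists2 s, regular_modulo (p i) s & s * x = 0) ->
  forall i, max_den R (regular_modulo (p i)).
Proof.
move=> lS kp.
have aP i := regular_modulo_ass (tp i) (proj1 (pp i)) (proj1 (gp i)) (kp i).
move=> i; split; first by have [] := aP i.
move=> T dT iT; have [j [Tj _ _]] := denominator_set_decomposition dT (lS T dT).
have ij : i = j.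
  by apply: regular_modulo_inj; [have [] := aP i|have [] := aP j|exact: subset_trans Tj].
by apply/seteqP; split=> //; rewrite ij.
Qed.

(** A prime over l contains some [p i]: otherwise prime avoidance yields an element of all [p i],
    hence of l, outside it. *)
Lemma decomposition_min_primes (q : properIdeal R) :
  min_primes R l q <-> exists i, (q : set R) = p i.
Proof.
have contains (q' : set R) : two_sided_ideal q' -> prime_modulo q' -> l `<=` q' ->
    exists i, p i `<=` q'.
  move=> tq pq lq; apply: contrapT => h.
  have [|y qy hy] := @prime_avoidance R I q' p (enum I) tp pq.
    by move=> i _ pq'; apply: h; exists i.
  by apply: qy; apply: lq; apply/lE => i; apply: hy; rewrite mem_enum.
split=> [[/prime_idealP[tq pq] lq minq]|[i qi]].
  have [i piq] := contains _ tq pq lq; exists i; apply/esym/minq => //.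
    by apply/prime_idealP.
  by move=> x /lE.
split; rewrite ?qi.
- by apply/prime_idealP.
- by move=> x /lE.
- move=> q' /prime_idealP[tq' pq'] lq' q'p; have [j pj] := contains _ tq' pq' lq'.
  have ji := incomparable (subset_trans pj q'p); rewrite ji in pj.
  exact/seteqP.
Qed.

End Decomposition.

Section LocalizationRadicalDecomposition.
Variables (R : nzRingType) (I : finType) (p : I -> set R).
Let l := @localization_radical_set R.
Hypothesis dec : goldie_decomposition l p.

Let l_ass S : max_den R S -> l `<=` ass S. Proof. by move=> mS x; apply. Qed.

(* If [regular_modulo (p i)] were not among the maximal denominator sets, an
   element of the other primes regular modulo [p i] would lie in [l]. *)
Lemma max_den_regular_modulo i :
  max_den R (regular_modulo (p i)) /\ ass (regular_modulo (p i)) = p i.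
Proof.
have [tp pp incomparable _ lE] := dec.
have [S [mS Si]] : exists S, max_den R S /\ ass S `<=` p i.
  apply: contrapT => h; have [d rd pd] := decomposition_separator dec i.
  have pid : p i d.
    apply: (proj1 (lE d)) => S mS; have [j _ aj] := max_den_decomposition dec mS (l_ass mS).
    rewrite aj; apply: pd; apply/eqP => ji; apply: h; exists S; split=> //.
    by rewrite aj ji.
  by have [p1 _] := pp i; apply: p1; apply: (rd 1).1; rewrite mulr1.
have [j SE aj] := max_den_decomposition dec mS (l_ass mS).
have ji : j = i by apply: incomparable; rewrite -aj.
by rewrite -ji -SE.
Qed.

Lemma max_denP S : max_den R S <-> exists i, S = regular_modulo (p i).
Proof.
split=> [mS|[i ->]]; last by have [] := max_den_regular_modulo i.
by have [i ->] := max_den_decomposition dec mS (l_ass mS); exists i.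
Qed.

End LocalizationRadicalDecomposition.

(** * Minimal primes of a semiprime left Goldie ring *)

Section SemiprimeGoldie.
Variable A : nzRingType.
Implicit Types (I J N P : set A) (r x y z : A).
Hypotheses (spA : semiprime_ring A) (gA : left_goldie A).

Let sp := semiprime_elements spA.
Let accA : acc_left_annihilators A := gA.1.
Let udimA : finite_udim A. Proof. exact/finite_udimP/gA.2. Qed.

Definition maximal_annihilator P : Prop :=
  exists I, [/\ two_sided_ideal I, exists2 x, I x & x != 0, P = left_annihilator I
    & forall J, two_sided_ideal J -> (exists2 x, J x & x != 0) ->
        left_annihilator I `<=` left_annihilator J ->
        left_annihilator J `<=` left_annihilator I].

(** If the products on one side vanish, each product z on the other side satisfies z A z = 0, so
    semiprimeness applies. *)
Lemma annihilator_sym I x : two_sided_ideal I ->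
  left_annihilator I x <-> forall y, I y -> y * x = 0.
Proof.
move=> [[_ _ IM] IMr]; split=> h y Iy; apply: sp => r.
  have -> : y * x * r * (y * x) = y * (x * (r * y)) * x by rewrite !mulrA.
  by rewrite h ?mulr0 ?mul0r //; exact: IM.
have -> : x * y * r * (x * y) = x * (y * r * x) * y by rewrite !mulrA.
by rewrite h ?mulr0 ?mul0r //; exact: IMr.
Qed.

Lemma two_sided_ideal_annihilator I : two_sided_ideal I ->
  two_sided_ideal (left_annihilator I).
Proof.
move=> [[_ _ IM] _]; split; [split|].
- by move=> x _; rewrite mul0r.
- by move=> x y hx hy z Iz; rewrite mulrDl hx ?hy ?addr0.
- by move=> a x hx z Iz; rewrite -mulrA hx ?mulr0.
- by move=> a x hx z Iz; rewrite -mulrA hx //; exact: IM.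
Qed.

Lemma annihilator_disjoint I x : two_sided_ideal I -> I x -> left_annihilator I x -> x = 0.
Proof. by move=> [[_ _ IM] _] Ix hx; apply: sp => r; rewrite -mulrA hx //; exact: IM. Qed.

(** For y outside P, the z in [I] with x A z = 0 form an ideal containing some y j that is not 0. By
    maximality its annihilator is that of [I], and x belongs to it. *)
Lemma maximal_annihilator_prime P : maximal_annihilator P -> prime_modulo P.
Proof.
move=> [I [tI [i Ii i0] -> maxI]]; split; first by move=> /(_ i Ii) /eqP; rewrite mul1r (negPf i0).
move=> x y xy; apply: contrapT => /not_orP[px py].
have [j /not_implyP[Ij /eqP yj]] : exists j, ~ (I j -> y * j = 0) by apply/existsNP.
have [[I0 ID IM] IMr] := tI.
pose J := [set z | I z /\ forall r, x * r * z = 0].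
apply: px; apply: (maxI J) => [||r hr z [Iz _]|z [_ /(_ 1)]].
- split; [split|].
  + by split=> // r; rewrite mulr0.
  + by move=> a b [? ha] [? hb]; split=> [|r]; [exact: ID|rewrite mulrDr ha hb addr0].
  + by move=> a b [? hb]; split=> [|r]; [exact: IM|rewrite mulrA -(mulrA x) hb].
  + by move=> a b [? hb]; split=> [|r]; [exact: IMr|rewrite mulrA hb mul0r].
- exists (y * j) => //; split=> [|r]; first exact: IM.
  by rewrite mulrA; exact: xy.
- exact: hr.
- by rewrite mulr1.
Qed.

Lemma maximal_annihilator_incomparable P P' : maximal_annihilator P ->
  maximal_annihilator P' -> P `<=` P' -> P = P'.
Proof.
move=> [I [_ _ -> maxI]] [I' [tI' nI' -> _]] h; apply/seteqP; split=> //.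
exact: maxI.
Qed.

(** If the intersection [N] were nonzero, take the annihilator of I maximal above that of N. Then N
    annihilates I, so I lies in the annihilator of N, hence in its own, and I would be 0. *)
Lemma bigcap_maximal_annihilator x : (forall P, maximal_annihilator P -> P x) -> x = 0.
Proof.
move=> hx; apply/eqP; apply: contrapT => /negP x0.
pose N := [set z | forall P, maximal_annihilator P -> P z].
have tP P : maximal_annihilator P -> two_sided_ideal P.
  by move=> [I [tI _ -> _]]; exact: two_sided_ideal_annihilator.
have tN : two_sided_ideal N.
  split; [split|].
  - by move=> P /tP[[]].
  - by move=> a b ha hb P mP; have [[_ PD _] _] := tP P mP; apply: PD; [exact: ha|exact: hb].
  - by move=> a b hb P mP; have [[_ _ PM] _] := tP P mP; apply: PM; exact: hb.
  - by move=> a b hb P mP; have [_ PM] := tP P mP; apply: PM; exact: hb.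
pose F : set (set A) := [set I | [/\ two_sided_ideal I, exists2 z, I z & z != 0
   & left_annihilator N `<=` left_annihilator I]].
have [|I [tI [i Ii i0] NI] maxI] := @acc_left_annihilators_max _ F accA.
  by exists N; split=> //; exists x.
have mI : maximal_annihilator (left_annihilator I).
  exists I; split=> // [|J tJ nJ IJ]; first by exists i.
  by apply: maxI => //; split=> //; exact: subset_trans IJ.
case/eqP: i0; apply: (annihilator_disjoint tI Ii); apply: NI.
by apply/(annihilator_sym _ tN) => z /(_ _ mI); exact.
Qed.

(** From distinct annihilators P_n of I_n, choose nonzero a_n in I_n. Primeness puts a_m in P_n for
    m distinct from n, so the a_n are independent because I_n meets P_n in 0. *)
Lemma finite_maximal_annihilator : finite_set maximal_annihilator.
Proof.
apply: contrapT => /infiniteP /pcard_leP[f].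
have fP n : maximal_annihilator (f n) by have := @funS _ _ _ _ f n I.
have finj n m : f n = f m -> n = m by apply: (@inj _ _ _ f); rewrite inE.
have hI n : exists Ia : set A * A, [/\ two_sided_ideal Ia.1, Ia.1 Ia.2, Ia.2 != 0
    & f n = left_annihilator Ia.1].
  by have [I [tI [a Ia a0] fE _]] := fP n; exists (I, a).
have [Ia IaP] := choice hI.
pose a n := (Ia n).2.
have fa m n : m <> n -> f n (a m).
  move=> mn; have [tI Im _ fE] := IaP m; have [_ hp] := maximal_annihilator_prime (fP n).
  have /existsNP[x /not_implyP[fx nfx]] : ~ f m `<=` f n.
    by move=> /(maximal_annihilator_incomparable (fP m) (fP n))/finj.
  have [r||//] := hp x (a m); last by move=> /nfx.
  have [[f0 _ _] _] : two_sided_ideal (f n).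
    by have [? _ _ ->] := IaP n; exact: two_sided_ideal_annihilator.
  rewrite -mulrA; move: fx; rewrite fE => -> //.
  by case: tI => -[_ _ IM] _; exact: IM.
apply: (udimA (a := a)) => [n|n r r0 i lin]; first by have [] := IaP n.
have [tI Ii _ fE] := IaP i; apply: (annihilator_disjoint tI); first by case: tI => -[_ _ + _]; exact.
rewrite -fE; have [lf _] : two_sided_ideal (f i) by rewrite fE; exact: two_sided_ideal_annihilator.
have -> : r i * a i = - \sum_(j < n | j != Ordinal lin) r j * a j.
  by move: r0; rewrite (bigD1 (Ordinal lin)) //= => /eqP; rewrite addr_eq0 => /eqP.
apply: left_idealN => //; case: lf => f0 fD fM.
elim/big_ind: _ => // j ji; apply/fM/fa => e; case/eqP: ji; exact: val_inj.
Qed.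

(** P is the annihilator of [I] on both sides. Left annihilators in A/P pull back to those of
    products x i in A, and independent elements of A/P, lifted and multiplied on the left by
    elements of [I], stay independent in A. *)
Lemma maximal_annihilator_goldie P : maximal_annihilator P -> goldie_modulo P.
Proof.
move=> mP; have pP := maximal_annihilator_prime mP; have [I [tI _ PE _]] := mP.
have tP : two_sided_ideal P by rewrite PE; exact: two_sided_ideal_annihilator.
pose J := Defs.ProperIdeal tP (proj1 pP); pose g : {rmorphism A -> quot_ring J} := quot_pi J.
have gsurj : forall a, exists r, g r = a := @quot_pi_surj _ J.
have g0 x : g x = 0 <-> P x := @quot_pi_eq0 _ J x.
apply: (proj1 (@goldie_order_quot A J)); apply: goldie.
- by apply: prime_ring_semiprime; apply/prime_ring_quot.
- have symP x : P x <-> forall y, I y -> y * x = 0.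
    by rewrite PE; exact: annihilator_sym.
  have IM a x : I x -> I (a * x) by case: tI => -[_ _ + _]; exact.
  split.
    move=> X sX; pose Y n := [set z | exists x i, [/\ X n (g x), I i & z = x * i]].
    have annY n r : left_annihilator (X n) (g r) <-> left_annihilator (Y n) r.
      split=> [h _ [x [i [Xx Ii ->]]]|h a].
        have : P (r * x) by apply/g0; rewrite rmorphM h.
        by rewrite PE mulrA => ->.
      have [x <-] := gsurj a; move=> Xx; rewrite -rmorphM; apply/g0; rewrite PE => i Ii.
      by rewrite -mulrA h //; exists x, i.
    have [m hm] : exists m, forall n, (m <= n)%N ->
        left_annihilator (Y n) = left_annihilator (Y m).
      by apply: accA => n r /annY/sX/annY.
    exists m => n /hm YN; apply/seteqP; split=> a; have [r <-] := gsurj a.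
      by move=> /annY; rewrite YN => /annY.
    by move=> /annY; rewrite -YN => /annY.
  apply/finite_udimP => a a0 ia.
  have hx n : exists iy : A * A, [/\ I iy.1, iy.1 * iy.2 != 0 & g iy.2 = a n].
    have [y yE] := gsurj (a n).
    have /existsNP[i /not_implyP[Ii /eqP iy]] : ~ forall i, I i -> i * y = 0.
      by move=> /symP/g0 gy; have := a0 n; rewrite -yE gy eqxx.
    by exists (i, y).
  have [iy iyP] := choice hx.
  apply: (udimA (a := fun n => (iy n).1 * (iy n).2)) => [n|n r r0 k lkn].
    by have [] := iyP n.
  have [Ik _ ak] := iyP k; apply: (annihilator_disjoint tI).
    by apply: IM; case: tI => _; exact.
  rewrite -PE; apply/g0; rewrite mulrA rmorphM ak.
  apply: (ia n (fun k => g (r k * (iy k).1))) => //.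
  rewrite -[RHS](rmorph0 g) -r0 rmorph_sum; apply: eq_bigr => j _.
  by have [_ _ <-] := iyP j; rewrite -rmorphM mulrA.
Qed.

Lemma semiprime_goldie_decomposition : exists (n : nat) (p : 'I_n -> set A),
  goldie_decomposition [set 0] p.
Proof.
have [n [f [fP finj fsurj]]] := finite_set_enum finite_maximal_annihilator.
exists n, f; split=> [i|i|i j fij|i|x].
- by have [I [tI _ -> _]] := fP i; exact: two_sided_ideal_annihilator.
- exact: maximal_annihilator_prime.
- exact/finj/(maximal_annihilator_incomparable (fP i) (fP j) fij).
- exact: maximal_annihilator_goldie.
- split=> [-> i|h]; first by have [I [_ _ -> _]] := fP i; move=> y _; rewrite mul0r.
  apply: bigcap_maximal_annihilator => P /fsurj[i <-]; exact: h.
Qed.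

End SemiprimeGoldie.

(** * The localization map and its universal property *)

Section QuotientLift.
Variables (R B : nzRingType) (J : properIdeal R) (f : {rmorphism R -> B}).
Hypothesis fJ : forall x, (J : set R) x -> f x = 0.

(** The unnamed argument keeps the vanishing hypothesis in the term, where the morphism structures
    below find it. *)
Definition quot_lift of (forall x, (J : set R) x -> f x = 0) :=
  fun a : quot_ring J => f (repr a).

Lemma quot_liftE x : quot_lift fJ (quot_pi J x) = f x.
Proof.
apply/subr0_eq; rewrite -rmorphB; apply: fJ; apply/quot_piP.
exact: quot_pi_repr.
Qed.

Lemma quot_lift_is_zmod_morphism : zmod_morphism (quot_lift fJ).
Proof.
elim/quot_piW => x; elim/quot_piW => y.
by rewrite -rmorphB !quot_liftE rmorphB.
Qed.

Lemma quot_lift_is_monoid_morphism : monoid_morphism (quot_lift fJ).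
Proof.
split; first by rewrite -(rmorph1 (quot_pi J)) quot_liftE rmorph1.
elim/quot_piW => x; elim/quot_piW => y.
by rewrite -rmorphM !quot_liftE rmorphM.
Qed.

HB.instance Definition _ := GRing.isZmodMorphism.Build (quot_ring J) B
  (quot_lift fJ) quot_lift_is_zmod_morphism.
HB.instance Definition _ := GRing.isMonoidMorphism.Build (quot_ring J) B
  (quot_lift fJ) quot_lift_is_monoid_morphism.

End QuotientLift.

Section LocalizationMap.
Variables (R : nzRingType) (S : set R) (dS : left_den_set S).
Implicit Types (r s : R).

Lemma left_den_set_mem1 : S 1. Proof. by case: dS => -[[]]. Qed.

Definition loc_map r : left_loc dS := mkfrac dS r left_den_set_mem1.

Lemma loc_map_is_zmod_morphism : zmod_morphism loc_map.
Proof.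
move=> x y; rewrite /loc_map.
have -> : - mkfrac dS y left_den_set_mem1 = mkfrac dS (- y) left_den_set_mem1.
  exact: loc_oppE.
by symmetry; exact: mkfracD.
Qed.

Lemma loc_map_is_monoid_morphism : monoid_morphism loc_map.
Proof.
have S11 : S (1 * 1) by rewrite mulr1; exact: left_den_set_mem1.
split; first exact: mkfrac_irr.
move=> x y.
have e : loc_map x * loc_map y = mkfrac dS (x * y) S11.
  by apply: loc_mulE; rewrite mul1r mulr1.
by rewrite e; apply: mkfrac_eq; rewrite ?mulr1.
Qed.

HB.instance Definition _ := GRing.isZmodMorphism.Build R (left_loc dS)
  loc_map loc_map_is_zmod_morphism.
HB.instance Definition _ := GRing.isMonoidMorphism.Build R (left_loc dS)
  loc_map loc_map_is_monoid_morphism.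

Lemma loc_map_eq0 r : loc_map r = 0 <-> ass S r.
Proof.
split=> [/mkfracP[a [b]]|[s Ss sr]].
  by rewrite !mulr1 mulr0 => -[Sa _ ar]; exists a.
apply/mkfracP; exists s, s; rewrite mulr1 mulr0; split=> //.
Qed.

Lemma loc_map_mkfrac s r (Ss : S s) : loc_map s * mkfrac dS r Ss = loc_map r.
Proof.
have S11 : S (1 * 1) by rewrite mulr1; exact: left_den_set_mem1.
have e : loc_map s * mkfrac dS r Ss = mkfrac dS (1 * r) S11.
  by apply: loc_mulE; rewrite mul1r.
by rewrite e; apply: mkfrac_eq; rewrite mul1r.
Qed.

Lemma loc_map_unit s : S s -> exists u, u * loc_map s = 1 /\ loc_map s * u = 1.
Proof.
move=> Ss; exists (mkfrac dS 1 Ss); split; last by rewrite loc_map_mkfrac rmorph1.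
have S1s : S (1 * s) by rewrite mul1r.
have -> : mkfrac dS 1 Ss * loc_map s = mkfrac dS (1 * s) S1s.
  by apply: loc_mulE.
by apply/mkfracP; exists 1, s; rewrite !mul1r mulr1.
Qed.

Lemma loc_map_frac (b : left_loc dS) : exists s r, S s /\ loc_map s * b = loc_map r.
Proof.
elim/mkfracW: b => s r Ss; exists s, r; split=> //; exact: loc_map_mkfrac.
Qed.

Lemma left_fractions_loc : ass S = [set 0] -> left_fractions loc_map S.
Proof.
move=> S0; split.
- move=> x y e; apply/subr0_eq; have : ass S (x - y).
    by apply/loc_map_eq0; rewrite rmorphB e subrr.
  by rewrite S0.
- by move=> s t; case: dS => -[[_ _ +] _] _; exact.
- exact: loc_map_unit.
- exact: loc_map_frac.
Qed.

Lemma left_fractions_quot (p : properIdeal R) : (p : set R) = ass S ->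
  exists f : {rmorphism quot_ring p -> left_loc dS}, left_fractions f (quot_pi p @` S).
Proof.
move=> pS; have pS0 x : (p : set R) x -> loc_map x = 0 by rewrite pS => /loc_map_eq0.
pose f : {rmorphism quot_ring p -> left_loc dS} := quot_lift pS0.
have fE x : f (quot_pi p x) = loc_map x by exact: quot_liftE.
exists f; split.
- elim/quot_piW => x; elim/quot_piW => y; rewrite !fE => e.
  by apply/quot_piP; rewrite pS; apply/loc_map_eq0; rewrite loc_map_is_zmod_morphism e subrr.
- move=> _ _ [s Ss <-] [t St <-]; exists (s * t); last by rewrite rmorphM.
  by case: dS => -[[_ _ +] _] _; exact.
- by move=> _ [s Ss <-]; rewrite fE; exact: loc_map_unit.
- move=> b; have [s [r [Ss e]]] := loc_map_frac b.
  exists (quot_pi p s), (quot_pi p r); rewrite !fE; split=> //.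
Qed.

Section Universal.
Variables (B : nzRingType) (f : {rmorphism R -> B}).
Hypothesis fS : forall s, S s -> exists w, w * f s = 1 /\ f s * w = 1.
Implicit Types (u v : left_loc dS).

Let cancelS s x y : S s -> f s * x = f s * y -> x = y.
Proof.
move=> /fS[v [vs _]] e; by rewrite -(mul1r x) -vs -mulrA e mulrA vs mul1r.
Qed.

Fact loc_lift_subproof u : exists b, f (den (repr u)) * b = f (num (repr u)).
Proof.
have [v [_ sv]] := fS (denP (repr u)).
by exists (v * f (num (repr u))); rewrite mulrA sv mul1r.
Qed.

Definition loc_lift of (forall s, S s -> exists w, w * f s = 1 /\ f s * w = 1) :=
  fun u : left_loc dS => projT1 (cid (loc_lift_subproof u)).

Lemma loc_liftE s r (Ss : S s) : f s * loc_lift fS (mkfrac dS r Ss) = f r.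
Proof.
set u := mkfrac dS r Ss; have := projT2 (cid (loc_lift_subproof u)).
rewrite -/(loc_lift fS u); set b := loc_lift fS u => bE.
have /mkfracP[c [d [Sc cd cr]]] := esym (mkfrac_repr u).
(* Only c s, not c, is known to lie in S; f(c) is cancelled after writing x as f(s) v x. *)
have cancel_c x y : f c * x = f c * y -> x = y.
  have [v [vs sv]] := fS Ss; move=> e.
  have vV z : f s * (v * z) = z by rewrite mulrA sv mul1r.
  rewrite -(vV x) -(vV y); congr (_ * _).
  by apply: (cancelS Sc); rewrite rmorphM -!mulrA !vV.
by apply: cancel_c; rewrite mulrA -!rmorphM cd cr !rmorphM -mulrA bE.
Qed.

Lemma loc_lift_is_zmod_morphism : zmod_morphism (loc_lift fS).
Proof.
move=> u v; have [s [Ss [r [r' [-> ->]]]]] := common_den2 u v.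
have -> : mkfrac dS r Ss - mkfrac dS r' Ss = mkfrac dS (r - r') Ss.
  have -> : - mkfrac dS r' Ss = mkfrac dS (- r') Ss by exact: loc_oppE.
  exact: mkfracD.
by apply: (cancelS Ss); rewrite mulrBr !loc_liftE rmorphB.
Qed.

Lemma loc_lift_is_monoid_morphism : monoid_morphism (loc_lift fS).
Proof.
split.
  by apply: (cancelS left_den_set_mem1); rewrite loc_liftE rmorph1 mulr1.
elim/mkfracW=> s r Ss; elim/mkfracW=> s' r' Ss'.
have [[[_ _ SM] ore] _] := dS; have [t [q [St tq]]] := ore r s' Ss'.
have Sts := SM _ _ St Ss.
have -> : mkfrac dS r Ss * mkfrac dS r' Ss' = mkfrac dS (q * r') Sts.
  exact: loc_mulE.
apply: (cancelS Sts); rewrite loc_liftE (rmorphM f t s) -mulrA (mulrA (f s)) loc_liftE.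
by rewrite mulrA -(rmorphM f t r) tq !rmorphM -mulrA loc_liftE.
Qed.

HB.instance Definition _ := GRing.isZmodMorphism.Build (left_loc dS) B
  (loc_lift fS) loc_lift_is_zmod_morphism.
HB.instance Definition _ := GRing.isMonoidMorphism.Build (left_loc dS) B
  (loc_lift fS) loc_lift_is_monoid_morphism.

Lemma loc_lift_isomorphic : (forall r, f r = 0 -> ass S r) ->
  (forall b, exists s r, S s /\ f s * b = f r) -> ring_isomorphic (left_loc dS) B.
Proof.
move=> kerf fracs; exists (loc_lift fS).
have linj : injective (loc_lift fS).
  move=> u v e; apply/subr0_eq; move: (u - v) (loc_lift_is_zmod_morphism u v) => w.
  rewrite e subrr; elim/mkfracW: w => s r Ss l0.
  have /kerf[t St tr] : f r = 0 by rewrite -(loc_liftE r Ss) l0 mulr0.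
  have [[[_ _ SM] _] _] := dS.
  apply/mkfracP; exists t, (t * s); rewrite tr !mulr0 mulr1; split=> //; exact: SM.
have lsurj b : exists u, loc_lift fS u = b.
  have [s [r [Ss sb]]] := fracs b; exists (mkfrac dS r Ss).
  by apply: (cancelS Ss); rewrite loc_liftE sb.
have [g gP] := choice lsurj.
by exists g => // u; apply: linj; rewrite gP.
Qed.

End Universal.
End LocalizationMap.

(** * The quotient by the localization radical *)

(** The localization is the ring of left fractions of R/p at all its regular elements. *)
Lemma left_loc_simple (R : nzRingType) (S : set R) (dS : left_den_set S) (p : properIdeal R) :
  S = regular_modulo p -> ass S = p -> prime_modulo p -> goldie_modulo p ->
  simple_left_artinian (left_loc dS).
Proof.
move=> SE aS pp gp; have [f fS] := left_fractions_quot dS (esym aS).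
have SR : quot_pi p @` S = regular (quot_ring p).
  rewrite SE -(quot_pi_kernel p) (regular_modulo_preimage (@quot_pi_surj _ p)) regular_modulo0.
  exact/image_preimage/quot_pi_range.
have oQ : goldie_order (quot_ring p) by apply/goldie_order_quot.
split; last exact/left_semisimple_artinian/(goldie_order_left_semisimple fS SR oQ).
by apply: (goldie_order_simple fS SR oQ); apply/prime_ring_quot.
Qed.

Lemma simple_left_loc (R : nzRingType) (S : set R) (dS : left_den_set S) (p : properIdeal R) :
  (p : set R) = ass S -> simple_left_artinian (left_loc dS) ->
  [/\ prime_modulo p, goldie_modulo p & left_goldie (quot_ring p)].
Proof.
move=> pS sS; have [f fS] := left_fractions_quot dS pS.
have ssB := simple_artinian_left_semisimple sS; split.
- by apply/prime_ring_quot; apply: (fractions_prime fS ssB); case: sS.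
- by apply/goldie_order_quot; exact: (fractions_goldie_order fS ssB).
- by have [] := fractions_goldie fS ssB.
Qed.

Lemma prime_goldie_modulo (R : nzRingType) (p : properIdeal R) :
  prime_ideal p -> left_goldie (quot_ring p) -> goldie_modulo p.
Proof.
move=> /prime_idealP[_ pp] gp; apply/goldie_order_quot/goldie => //.
by apply: prime_ring_semiprime; apply/prime_ring_quot.
Qed.

Section LeftQuotientRing.
Variable A : nzRingType.

Lemma left_fractions_quotient_ring (h : left_ore_set (regular A)) :
  left_fractions (loc_map (regular_left_den h)) (regular A).
Proof.
apply: left_fractions_loc; apply/seteqP; split=> [x [s [ls _] sx]|x ->].
  by apply: ls; rewrite sx mulr0.
by exists 1; rewrite ?mulr0 //; case: h => -[].
Qed.

Lemma goldie_order_quotient_ring : goldie_order A ->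
  exists h : left_ore_set (regular A), semisimple_artinian (left_quotient_ring h).
Proof.
move=> oA; exists oA.1; apply: left_semisimple_semisimple_artinian.
exact: (goldie_order_left_semisimple (left_fractions_quotient_ring oA.1)).
Qed.

Lemma quotient_ring_goldie (h : left_ore_set (regular A)) :
  semisimple_artinian (left_quotient_ring h) -> semiprime_ring A /\ left_goldie A.
Proof.
move=> /semisimple_artinian_left_semisimple.
exact: (fractions_goldie (left_fractions_quotient_ring h)).
Qed.

End LeftQuotientRing.

(** * Decompositions from minimal primes and from maximal denominator sets *)

Section ExistenceOfDecompositions.
Variable R : nzRingType.

Lemma min_primes_decomposition (l : set R) :
  l = \bigcap_(p in min_primes R l) (p : set R) -> finite_set (min_primes R l) ->
  (forall p, min_primes R l p -> goldie_modulo p) ->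
  exists n (p : 'I_n -> set R), goldie_decomposition l p.
Proof.
move=> lE finl gl.
have [n [f [fP finj fsurj]]] := finite_set_enum (finite_image (@properIdeal_set R) finl).
exists n, f; split=> [i|i|i j fij|i|x].
- by have [p _ <-] := fP i; exact: properIdeal_two_sided.
- by have [p [/prime_idealP[_ pp] _ _] <-] := fP i.
- have [p [pp lp _] pE] := fP i; have [q [_ _ minq] qE] := fP j.
  by apply: finj; rewrite -pE -qE; apply: minq; rewrite // pE qE.
- by have [p mp <-] := fP i; exact: gl.
- rewrite {1}lE; split=> [h i|h p mp]; first by have [p mp <-] := fP i; exact: h.
  by have [|i <-] := fsurj (p : set R); [exists p|exact: h].
Qed.

(** The primes are the [ass (S i)]. Elements of [S i] are regular modulo [ass (S i)], and all such
    regular elements form a denominator set, so by maximality [S i] is recovered from its prime. *)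
Lemma max_den_simple_decomposition : finite_set (max_den R) ->
  (forall S (mS : max_den R S), simple_left_artinian (left_loc (proj1 mS))) ->
  exists n (p : 'I_n -> set R), goldie_decomposition (@localization_radical_set R) p.
Proof.
move=> finR sR; have [n [S [mS Sinj Ssurj]]] := finite_set_enum finR.
have assS i := let J := Defs.ProperIdeal (ass_two_sided_ideal (mS i).1) (@ass_proper R _ (mS i).1)
  in @simple_left_loc R (S i) (mS i).1 J erefl (sR _ (mS i)).
have tS i := ass_two_sided_ideal (mS i).1.
have SE i : S i = regular_modulo (ass (S i)).
  have [[ap1 _] [ore _] _] := assS i; have [_ maxS] := mS i; have [dS _] := mS i.
  have SR : S i `<=` regular_modulo (ass (S i)).
    by move=> s Ss x; split=> h; apply: (two_sided_ideal_ass dS Ss); [left|right].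
  apply/esym/maxS => //.
  have [|//] := regular_modulo_ass (tS i) ap1 ore.
  by move=> x [s Ss sx]; exists s => //; exact: SR.
exists n, (fun i => ass (S i)); split=> // [i|i j aij|i|x].
- by have [] := assS i.
- apply: Sinj; rewrite (SE i) (SE j); congr regular_modulo; apply/seteqP; split=> //.
  apply: contrapT => naji.
  (* otherwise a nonzero ideal of the prime ring [R / ass (S i)] provides an
     element of [ass (S j)] regular modulo [ass (S i)] *)
  have [[_ pp] [_ gi] _] := assS i.
  have [y ay|c [s Ss sc] rc] := gi (ass (S j)) (tS j).1 aij.
    have /existsNP[x /not_implyP[jx ix]] := naji.
    have /existsNP[r xry] : ~ forall r, ass (S i) (x * r * y) by move=> /pp[].
    by exists (x * r) => //; rewrite -mulrA; apply: (tS j).2.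
  have /aij[t St ts] : ass (S i) s.
    by apply: (rc s).2; rewrite sc; case: (tS i) => -[].
  have [[[[_ nS0 multS] _] _] _] := mS j; apply: nS0; rewrite -ts; exact: multS.
- by have [] := assS i.
- split=> [h i|h T /Ssurj[i <-]]; last exact: h.
  exact: h.
Qed.

End ExistenceOfDecompositions.

Lemma goldie_decomposition_preimage (R A : nzRingType) (g : {rmorphism R -> A})
    (gsurj : forall a, exists r, g r = a) (l : set A) (I : finType) (q : I -> set A) :
  goldie_decomposition l q -> goldie_decomposition (g @^-1` l) (fun i => g @^-1` q i).
Proof.
move=> [tq pq inq gq lq]; split=> [i|i|i j qij|i|x].
- exact: two_sided_ideal_preimage.
- exact: prime_modulo_preimage.
- by apply: inq => a; have [r <-] := gsurj a; exact: qij.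
- by apply/goldie_modulo_preimage.
- by rewrite /preimage /= lq.
Qed.

(** * The decomposition of zero in R/l and its preimage in R *)

Section RadicalQuotient.
Variables (R : nzRingType) (I : finType).
Let l := localization_radical R.
Let pi : {rmorphism R -> quot_ring l} := quot_pi l.
Variable q : I -> set (quot_ring l).
Hypothesis dec0 : goldie_decomposition [set 0] q.
Let p i := pi @^-1` q i.

Let pi_surj : forall a, exists r, pi r = a := @quot_pi_surj _ l.

Let dec : goldie_decomposition (@localization_radical_set R) p.
Proof.
have -> : @localization_radical_set R = pi @^-1` [set 0] by exact/esym/quot_pi_kernel.
exact: goldie_decomposition_preimage.
Qed.

Let p_ideal i : two_sided_ideal (p i). Proof. by case: dec. Qed.
Let p_prime i : prime_modulo (p i). Proof. by case: dec. Qed.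
Let p_goldie i : goldie_modulo (p i). Proof. by case: dec. Qed.

Definition radical_prime i : properIdeal R := Defs.ProperIdeal (p_ideal i) (p_prime i).1.

Lemma min_primes_radicalE : min_primes R l = range radical_prime.
Proof.
apply/seteqP; split=> P.
  by move=> /(decomposition_min_primes dec)[i Pi]; exists i => //; exact: properIdeal_inj.
by move=> [i _ <-]; apply/(decomposition_min_primes dec); exists i.
Qed.

Lemma radical_eq_bigcap : (l : set R) = \bigcap_(P in min_primes R l) (P : set R).
Proof.
have [_ _ _ _ lE] := dec; rewrite min_primes_radicalE; apply/seteqP; split=> x.
  by move=> /lE h _ [i _ <-]; exact: h.
by move=> h; apply/lE => i; apply: (h (radical_prime i)); exists i.
Qed.

Lemma finite_min_primes_radical : finite_set (min_primes R l).
Proof. by rewrite min_primes_radicalE; apply: finite_image; exact: finite_finset. Qed.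

Lemma regular_mod_radical_prime i :
  regular_mod (radical_prime i) = pi @^-1` regular_modulo (q i).
Proof. by rewrite regular_modE -(regular_modulo_preimage pi_surj). Qed.

Lemma image_regular_mod_radical_prime i :
  pi @` regular_mod (radical_prime i) = regular_modulo (q i).
Proof.
rewrite regular_mod_radical_prime; exact/image_preimage/quot_pi_range.
Qed.

Lemma regular_mod_radical_prime_den i :
  left_den_set (regular_mod (radical_prime i)) /\
  ass (regular_mod (radical_prime i)) = radical_prime i.
Proof. by rewrite regular_modE; have [[]] := max_den_regular_modulo dec i. Qed.

Lemma min_primes_den P : min_primes R l P ->
  left_den_set (regular_mod P) /\ ass (regular_mod P) = P.
Proof.
rewrite min_primes_radicalE => -[i _ <-]; exact: regular_mod_radical_prime_den.
Qed.

Lemma max_den_radicalE : max_den R = [set regular_mod P | P in min_primes R l].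
Proof.
rewrite min_primes_radicalE; apply/seteqP; split=> S.
  move=> /(max_denP dec)[i ->]; exists (radical_prime i); last by rewrite regular_modE.
  by exists i.
by move=> [_ [i _ <-] <-]; apply/(max_denP dec); exists i; rewrite regular_modE.
Qed.

Lemma quotient_max_den i :
  max_den (quot_ring l) (regular_modulo (q i)) /\ ass (regular_modulo (q i)) = q i.
Proof.
have [tq pq _ gq q0] := dec0.
(* The [q k] intersect in 0, so the separator d itself kills [q j]. *)
have killed j x : q j x -> exists2 s, regular_modulo (q j) s & s * x = 0.
  move=> qx; have [d rd qd] := decomposition_separator dec0 j; exists d => //.
  apply/q0 => k; have [->|kj] := eqVneq k j; first by case: (tq j) => -[_ _]; auto.
  by apply: (tq k).2; exact: qd.
split; last by have [] := regular_modulo_ass (tq i) (pq i).1 (gq i).1 (killed i).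
apply: (regular_modulo_max_den dec0) => // S dS _ ->.
by case: (ass_two_sided_ideal dS) => -[].
Qed.

Lemma max_den_quotientE :
  max_den (quot_ring l) = [set pi @` regular_mod P | P in min_primes R l].
Proof.
rewrite min_primes_radicalE; apply/seteqP; split=> T.
  move=> mT; have [|i -> _] := max_den_decomposition dec0 mT.
    by move=> _ ->; case: (ass_two_sided_ideal mT.1) => -[].
  exists (radical_prime i); last exact: image_regular_mod_radical_prime.
  by exists i.
move=> [_ [i _ <-] <-]; rewrite image_regular_mod_radical_prime.
by have [] := quotient_max_den i.
Qed.

Lemma regular_mod_saturated P : min_primes R l P ->
  regular_mod P = pi @^-1` (pi @` regular_mod P).
Proof.
rewrite min_primes_radicalE => -[i _ <-].
by rewrite image_regular_mod_radical_prime regular_mod_radical_prime.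
Qed.

Lemma image_regular_mod_den P : min_primes R l P ->
  left_den_set (pi @` regular_mod P) /\ ass (pi @` regular_mod P) = pi @` P.
Proof.
rewrite min_primes_radicalE => -[i _ <-]; rewrite image_regular_mod_radical_prime.
have [[dT _] ->] := quotient_max_den i; split=> //; symmetry; exact/image_preimage/quot_pi_range.
Qed.

Lemma left_loc_simple_radical P (dS : left_den_set (regular_mod P)) :
  min_primes R l P -> simple_left_artinian (left_loc dS).
Proof.
rewrite min_primes_radicalE => -[i _ Pi]; apply: (@left_loc_simple _ _ dS P).
- exact: regular_modE.
- by rewrite -Pi; have [] := regular_mod_radical_prime_den i.
- by rewrite -Pi; exact: p_prime.
- by rewrite -Pi; exact: p_goldie.
Qed.

Lemma left_loc_simple_quotient P (dT : left_den_set (pi @` regular_mod P)) :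
  min_primes R l P -> simple_left_artinian (left_loc dT).
Proof.
rewrite min_primes_radicalE => -[i _ Pi]; have [tq pq _ gq _] := dec0.
apply: (@left_loc_simple _ _ dT (Defs.ProperIdeal (tq i) (pq i).1)) => //=.
  by rewrite -Pi image_regular_mod_radical_prime.
by rewrite -Pi image_regular_mod_radical_prime; have [] := quotient_max_den i.
Qed.

(** The universal property is applied to the composite of [pi] with the localization map of R/l,
    whose kernel is P, that is [ass (regular_mod P)]. *)
Lemma left_loc_radical_isomorphic P (dS : left_den_set (regular_mod P))
    (dT : left_den_set (pi @` regular_mod P)) :
  min_primes R l P -> ring_isomorphic (left_loc dS) (left_loc dT).
Proof.
move=> mP; pose f : {rmorphism R -> left_loc dT} := loc_map dT \o pi.
apply: (@loc_lift_isomorphic _ _ dS _ f) => [s Ss|r fr|b].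
- by apply: loc_map_unit; exists s.
- have /loc_map_eq0 : loc_map dT (pi r) = 0 by [].
  have [_ ->] := image_regular_mod_den mP; move=> [x Px xr].
  move: mP Px xr; rewrite min_primes_radicalE => -[i _ <-] Px xr.
  have [_ ->] := regular_mod_radical_prime_den i.
  by move: Px; rewrite /= /p /preimage /= xr.
- have [_ [a [[s Ss <-] sb]]] := loc_map_frac b.
  by have [r ra] := pi_surj a; exists s, r; rewrite /f /= ra.
Qed.

End RadicalQuotient.

Theorem theorem8p1 (R : nzRingType) :
  let l : properIdeal R := localization_radical R in
  let Rl : nzRingType := quot_ring l in
  let pi : R -> Rl := quot_pi l in
  let Minl : set (properIdeal R) := min_primes R l in
  let Sp : properIdeal R -> set R := fun p => regular_mod p in
  let Spl : properIdeal R -> set Rl := fun p => pi @` Sp p in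
  let cond1 : Prop := exists h : left_ore_set (regular Rl),
    semisimple_artinian (left_quotient_ring h) in
  let cond1' : Prop := semiprime_ring Rl /\ left_goldie Rl in
  let cond2 : Prop :=
    finite_set (max_den R) /\
    forall (S : set R) (mS : max_den R S),
      simple_left_artinian (left_loc (proj1 mS)) in
  let cond3 : Prop :=
    [/\ (l : set R) = \bigcap_(p in Minl) (p : set R),
        finite_set Minl,
        forall p, Minl p -> left_den_set (Sp p) /\ ass (Sp p) = p,
        forall p, Minl p -> forall dS : left_den_set (Sp p),
          simple_left_artinian (left_loc dS)
      & forall p, Minl p -> forall x, (l : set R) x ->
          exists2 s, Sp p s & s * x = 0] in
  let cond4 : Prop :=
    [/\ (l : set R) = \bigcap_(p in Minl) (p : set R),
        finite_set Minl
      & forall p, Minl p -> left_goldie (quot_ring p)] in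
  [<-> cond1; cond1'; cond2; cond3; cond4] /\
  (cond1 \/ cond2 \/ cond3 ->
   [/\ [/\ set_bij (max_den R) (max_den Rl) (fun S => pi @` S),
           forall S, max_den R S -> pi @^-1` (pi @` S) = S
         & forall T, max_den Rl T -> pi @` (pi @^-1` T) = T],
       max_den R = [set Sp p | p in Minl],
       max_den Rl = [set Spl p | p in Minl]
     & forall p, Minl p ->
         [/\ Sp p = pi @^-1` Spl p,
             ass (Spl p) = pi @` ass (Sp p)
           & exists (dS : left_den_set (Sp p)) (dSl : left_den_set (Spl p)),
               [/\ ring_isomorphic (left_loc dS) (left_loc dSl),
                   simple_left_artinian (left_loc dS)
                 & simple_left_artinian (left_loc dSl)]]]).
Proof.
move=> l Rl pi Minl Sp Spl cond1 cond1' cond2 cond3 cond4.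
(* All consequences of condition 1 come from a decomposition of 0 in R/l. Conditions 2 and 4 produce
   a decomposition of l in R, and [order_l] leads from it back to condition 1. *)
have main : cond1' -> exists n (q : 'I_n -> set Rl), goldie_decomposition [set 0] q.
  by move=> [spRl gRl]; exact: semiprime_goldie_decomposition.
have goldieP : goldie_order Rl -> cond1 by exact: goldie_order_quotient_ring.
have cond11' : cond1 -> cond1' by move=> [h]; exact: quotient_ring_goldie.
have order_l n (p : 'I_n -> set R) :
    goldie_decomposition (@localization_radical_set R) p -> goldie_order Rl.
  by move=> dec; apply/goldie_order_quot; exact: decomposition_goldie_modulo dec.
have cond1'2 : cond1' -> cond2.
  move=> /main[n [q dec]]; split.
    by rewrite (max_den_radicalE dec); apply: finite_image; exact: finite_min_primes_radical dec.
  move=> S mS; have := mS; rewrite {1}(max_den_radicalE dec) => -[P mP PS].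
  by case: _ / PS in mS *; exact: left_loc_simple_radical dec _ _ mP.
have cond21 : cond2 -> cond1.
  move=> [finR sR]; have [n [p dec]] := max_den_simple_decomposition finR sR.
  exact/goldieP/order_l/dec.
have cond1'3 : cond1' -> cond3.
  move=> /main[n [q dec]].
  have denP P (mP : Minl P) := min_primes_den dec mP.
  split=> //.
  - exact: radical_eq_bigcap dec.
  - exact: finite_min_primes_radical dec.
  - by move=> P mP dS; exact: left_loc_simple_radical dec _ _ mP.
  - move=> P mP x lx; have [_ assP] := denP P mP.
    have : (P : set R) x by have := lx; rewrite {1}(radical_eq_bigcap dec); exact.
    by rewrite -{1}assP.
have cond34 : cond3 -> cond4.
  move=> [lE finM denM sM _]; split=> // P mP; have [dS assP] := denM P mP.
  by have [] := simple_left_loc (esym assP) (sM P mP dS).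
have cond41 : cond4 -> cond1.
  move=> [lE finM gM].
  have [|n [p dec]] := min_primes_decomposition lE finM.
    by move=> P mP; have [pP _ _] := mP; apply: prime_goldie_modulo => //; exact: gM.
  exact/goldieP/order_l/dec.
split; first by tfae; [exact: cond11'|exact: cond1'2|by move=> /cond21/cond11'/cond1'3|exact: cond34|exact: cond41].
move=> c123; have {c123} /main[n [q dec]] : cond1'.
  by case: c123 => [/cond11'//|[/cond21/cond11'//|/cond34/cond41/cond11'//]].
have satM S : max_den R S -> pi @^-1` (pi @` S) = S.
  rewrite (max_den_radicalE dec) => -[P mP <-].
  exact/esym/(regular_mod_saturated dec).
split.
- split=> // [|T _]; last exact/image_preimage/quot_pi_range.
  split.
  + move=> S; rewrite (max_den_radicalE dec) (max_den_quotientE dec) => -[P mP <-].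
    by exists P.
  + by move=> S T; rewrite !inE => /satM SE /satM TE ST; rewrite -SE -TE ST.
  + move=> T; rewrite (max_den_quotientE dec) => -[P mP <-]; exists (Sp P) => //.
    by rewrite (max_den_radicalE dec); exists P.
- exact: max_den_radicalE dec.
- exact: max_den_quotientE dec.
- move=> P mP; have [dS assP] := min_primes_den dec mP.
  have [dT assT] := image_regular_mod_den dec mP.
  split; first exact: regular_mod_saturated dec _ mP.
    by rewrite assT assP.
  exists dS, dT; split.
  + exact: left_loc_radical_isomorphic dec _ _ _ mP.
  + exact: left_loc_simple_radical dec _ _ mP.
  + exact: left_loc_simple_quotient dec _ _ mP.
Qed.
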